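(* Let $d\in\mathbb{N}$, let $\{X_{\mathbf n}:\mathbf n\in\mathbb{Z}^d\}$ be a stationary real-valued random field with marginal distribution function $F$, let $\theta\in(0,1]$, and let $\boldsymbol\Delta(n)=(n,n,\ldots,n)\in\mathbb{N}^d$, $n\in\mathbb{N}$. Then $\{X_{\mathbf n}\}$ has the sectorial extremal index $\theta$ if and only if there exist $\gamma_{or},\gamma_{in}\in(0,1)$ and a non-decreasing sequence of real levels $\{v_{\boldsymbol\Delta(n)}\}_{n\in\mathbb{N}}$ such that $$P(M_{\boldsymbol\Delta(n)}\le v_{\boldsymbol\Delta(n)})\to\gamma_{or},\qquad F(v_{\boldsymbol\Delta(n)})^{n^d}\to\gamma_{in}\quad\text{as }n\to\infty,\qquad\theta=\frac{\ln\gamma_{or}}{\ln\gamma_{in}},$$ and for every $T>0$, $\beta_T^{\boldsymbol\Delta}(n)\to0$ as $n\to\infty$, where $$\beta^{\boldsymbol\Delta}_T(n)=\max_{\mathbf p(1)+\mathbf p(2)\le T\boldsymbol\Delta(n)}\Big|P\big(M_{\mathbf p(1)+\mathbf p(2)}\le v_{\boldsymbol\Delta(n)}\big)-\prod_{\mathbf i\in\{1,2\}^d}P\big(M_{(p_1(i_1),\ldots,p_d(i_d))}\le v_{\boldsymbol\Delta(n)}\big)\Big|,$$ the maximum being over $\mathbf p(1),\mathbf p(2)\in\mathbb{N}_0^d$ with $\mathbf p(1)+\mathbf p(2)\le T\boldsymbol\Delta(n)$.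
   Context: $\mathbb{N}=\{1,2,\ldots\}$, $\mathbb{N}_0=\mathbb{N}\cup\{0\}$; $\le$ on vectors is the coordinatewise partial order; $\mathbf 1=(1,\ldots,1)$. A random field is stationary if its finite-dimensional distributions are invariant under translations of $\mathbb{Z}^d$; $F(x)=P(X_{\mathbf 0}\le x)$. For $\mathbf n\in\mathbb{Z}^d$, $M_{\mathbf n}=\max\{X_{\mathbf k}:\mathbf 1\le\mathbf k\le\mathbf n\}$ if $\mathbf 1\le\mathbf n$, and $M_{\mathbf n}=-\infty$ otherwise (so $P(M_{\mathbf n}\le v)=1$ if some coordinate of $\mathbf n$ is $0$). $\mathbf n^*=n_1n_2\cdots n_d$. $\mathbf n\to\boldsymbol\infty$ means that every coordinate tends to infinity. A monotone curve in $\mathbb{N}^d$ is a map $\boldsymbol\psi:\mathbb{N}\to\mathbb{N}^d$ such that $\boldsymbol\psi(n)\to\boldsymbol\infty$, $\boldsymbol\psi(n)\le\boldsymbol\psi(n+1)$ and $\boldsymbol\psi(n)\ne\boldsymbol\psi(n+1)$ for all $n$, and $\boldsymbol\psi(n)^*/\boldsymbol\psi(n+1)^*\to1$ as $n\to\infty$. A distribution function $G$ is a phantom distribution function for $\{X_{\mathbf n}\}$ along $\boldsymbol\psi$ if $\sup_{x\in\mathbb{R}}|P(M_{\boldsymbol\psi(n)}\le x)-G(x)^{\boldsymbol\psi(n)^*}|\to0$ as $n\to\infty$. $\mathcal U_{\boldsymbol\Delta}$ is the class of all monotone curves $\boldsymbol\varphi$ for which there is a constant $C\ge1$ such that for all but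 finitely many $n\in\mathbb{N}$, $\boldsymbol\varphi(n)\in\bigcup_{j\in\mathbb{N}}[C^{-1}j,Cj]^d$. A distribution function $G$ is a sectorial phantom distribution function for $\{X_{\mathbf n}\}$ if it is a phantom distribution function for $\{X_{\mathbf n}\}$ along every $\boldsymbol\varphi\in\mathcal U_{\boldsymbol\Delta}$. The number $\theta\in(0,1]$ is the sectorial extremal index for $\{X_{\mathbf n}\}$ if $G(x)=P(X_{\mathbf 0}\le x)^\theta$, $x\in\mathbb{R}$, is a sectorial phantom distribution function for $\{X_{\mathbf n}\}$.
   Formalization: The direction from the sectorial extremal index to the levels additionally assumes that F is regular: F(F_*-)=1 and (1-F(x-))/(1-F(x))→1 as x→F_*-. Without this it fails (constant field X=0, θ=1), and the existence of the levels implies it. *)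

(* Defs.v *)
From mathcomp Require Import all_boot all_order all_algebra.
From mathcomp Require Import all_classical all_reals all_analysis.
Set Implicit Arguments.
Unset Strict Implicit.
Unset Printing Implicit Defensive.
Import Order.TTheory GRing.Theory Num.Theory.
Import numFieldNormedType.Exports.
Local Open Scope classical_set_scope.
Local Open Scope ring_scope.

Definition zvec (d : nat) (p : 'I_d -> nat) : {ffun 'I_d -> int} :=
  [ffun i => (p i)%:Z].

Definition Delta (d n : nat) : {ffun 'I_d -> nat} := [ffun=> n].

Definition vol (d : nat) (p : {ffun 'I_d -> nat}) : nat := (\prod_(i < d) p i)%N.

Section RandomField.
Context (R : realType) (d : nat) (disp : measure_display)
  (T : measurableType disp) (P : probability T R).
Implicit Type X : {ffun 'I_d -> int} -> {RV P >-> R}.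

Definition Pr (A : set T) : R := fine (P A).

Definition stationary X : Prop :=
  forall (m : nat) (k : m.-tuple {ffun 'I_d -> int}) (h : {ffun 'I_d -> int})
         (A : set (m.-tuple R)), measurable A ->
    P [set w | A [tuple X (tnth k j + h) w | j < m]] =
    P [set w | A [tuple X (tnth k j) w | j < m]].

Definition margF X (x : R) : R := fine (cdf (X 0) x).

(* The maximum over the empty index set is -oo, so M X n w = -oo unless 1 <= n. *)
Definition M X (n : {ffun 'I_d -> int}) (w : T) : \bar R :=
  ereal_sup [set (X k w)%:E | k in
    [set k : {ffun 'I_d -> int} | forall i, 1 <= k i <= n i]].

Definition PM X (n : {ffun 'I_d -> int}) (x : R) : R :=
  Pr [set w | (M X n w <= x%:E)%E].

End RandomField.

(* N = {1, 2, ...}: the value of a sequence at the index 0 is irrelevant. *)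
Definition monotone_curve (R : realType) (d : nat)
    (psi : nat -> {ffun 'I_d -> nat}) : Prop :=
  [/\ forall n, (0 < n)%N -> forall i, (0 < psi n i)%N,
      forall i, psi n i @[n --> \oo] --> \oo,
      forall n, (0 < n)%N ->
        (forall i, (psi n i <= psi n.+1 i)%N) /\ psi n <> psi n.+1
    & (vol (psi n))%:R / (vol (psi n.+1))%:R @[n --> \oo] --> (1 : R)].

Definition class_U_Delta (R : realType) (d : nat)
    (phi : nat -> {ffun 'I_d -> nat}) : Prop :=
  monotone_curve R phi /\
  exists2 C : R, 1 <= C &
    \forall n \near \oo, exists2 j : nat, (0 < j)%N &
      forall i, C^-1 * j%:R <= (phi n i)%:R <= C * j%:R.

Definition distribution_function (R : realType) (G : R -> R) : Prop :=
  [/\ {homo G : x y / x <= y}, right_continuous G,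
      G x @[x --> -oo] --> (0 : R) & G x @[x --> +oo] --> (1 : R)].

(* Regularity in the sense of O'Brien: with F_* = sup {x | F x < 1}, the left
   limit F(F_* -) is 1 and (1 - F(x-)) / (1 - F(x)) --> 1 as x tends to F_*
   from the left.  Here Y has distribution function F, so that
   1 - F(x-) = P(Y >= x) and 1 - F(x) = P(Y > x), and x < F_* iff F x < 1.
   Regularity of F is necessary for levels with F(v n) ^ (n ^ d) --> gin in
   (0, 1) to exist.  It does not follow from F^theta being a phantom
   distribution function: constant fields and i.i.d. geometric fields are
   counterexamples. *)
Definition tail_regular (R : realType) (disp : measure_display)
    (T : measurableType disp) (P : probability T R) (Y : {RV P >-> R}) : Prop :=
  (forall e : R, 0 < e -> exists x, 1 - e < fine (cdf Y x) < 1) /\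
  (forall e : R, 0 < e -> exists2 x0, fine (cdf Y x0) < 1 &
     forall x, x0 <= x -> fine (cdf Y x) < 1 ->
       `| Pr P [set w | x <= Y w] / Pr P [set w | x < Y w] - 1 | < e).

Section ExtremalIndex.
Context (R : realType) (d : nat) (disp : measure_display)
  (T : measurableType disp) (P : probability T R).
Implicit Type X : {ffun 'I_d -> int} -> {RV P >-> R}.

Definition phantom_along X (G : R -> R)
    (psi : nat -> {ffun 'I_d -> nat}) : Prop :=
  sup [set `| PM X (zvec (psi n)) x - G x ^+ vol (psi n) | | x in [set: R]]
    @[n --> \oo] --> (0 : R).

Definition sectorial_phantom X (G : R -> R) : Prop :=
  distribution_function G /\
  forall phi, class_U_Delta R phi -> phantom_along X G phi.

Definition sectorial_extremal_index X (theta : R) : Prop :=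
  sectorial_phantom X (fun x => margF X x `^ theta).

(* p(1) + p(2) <= t Delta(n) bounds every coordinate by the integer part of
   t n, so the maximum is over a finite type; its terms are nonnegative and
   p(1) = p(2) = 0 is admissible for 0 <= t, so the neutral element 0 is
   harmless.  A function i : 'I_d -> bool encodes the element of {1,2}^d with
   coordinate 2 at l iff i l. *)
Definition beta X (v : nat -> R) (t : R) (n : nat) : R :=
  let N := Num.truncn (t * n%:R) in
  \big[Num.max/0]_(p : {ffun 'I_d -> 'I_N.+1} * {ffun 'I_d -> 'I_N.+1} |
                   [forall l, (p.1 l + p.2 l)%N%:R <= t * n%:R])
    `| PM X (zvec (fun l => p.1 l + p.2 l)%N) (v n)
       - \prod_(i : {ffun 'I_d -> bool})
           PM X (zvec (fun l => if i l then p.2 l : nat else p.1 l : nat)) (v n) |.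

Definition sectorial_levels X (theta gor gin : R) (v : nat -> R) : Prop :=
  [/\ forall m n, (0 < m)%N -> (m <= n)%N -> v m <= v n,
      PM X (zvec (Delta d n)) (v n) @[n --> \oo] --> gor,
      margF X (v n) ^+ (n ^ d)%N @[n --> \oo] --> gin,
      theta = ln gor / ln gin
    & forall t : R, 0 < t -> beta X v t n @[n --> \oo] --> (0 : R)].

End ExtremalIndex.

(* Main.v *)
(** Write g(p, x) = P(M_p <= x).  Both sides of the equivalence amount to the
    same uniform statement: g(p, x) is close to F(x)^(theta p* ), uniformly in x
    and in all p with large coordinates lying in a cone max p <= K min p.

    From levels to uniformity: the vanishing of beta, used with p(2) nonzero in
    one coordinate only, makes g(., v_n) almost multiplicative under cutting a
    box.  Cutting Delta(n), and then any p <= T Delta(n), into cubes of side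
    n / k, and using n^d (1 - F(v_n)) = O(1) to discard the remainders, gives
    g(p, v_n) ~ gor^(p* / n^d) uniformly.  The powers of F(v_n) obey the same
    asymptotics, and monotonicity in x fills the gaps between levels.

    From curves to uniformity: if uniformity failed in some cone, a curve of
    class U_Delta could be threaded through infinitely many bad points, by
    increasing one coordinate by one at a time, always the lowest coordinate
    that has not reached its target.

    From uniformity to levels: tail regularity makes the (1 - 1/(2 n^d))-quantiles
    v_n satisfy F(v_n)^(n^d) -> exp(-1/2), and beta vanishes because p* is
    additive when a box is cut. *)

Require Import Defs.
From mathcomp Require Import all_boot all_order all_algebra.
From mathcomp Require Import all_classical all_reals all_analysis.
From mathcomp Require Import ring lra zify.
Set Implicit Arguments.
Unset Strict Implicit.
Unset Printing Implicit Defensive.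
Import Order.TTheory GRing.Theory Num.Theory.
Import numFieldNormedType.Exports.
Local Open Scope classical_set_scope.
Local Open Scope ring_scope.

(** * Real-valued probabilities of events and their elementary bounds *)

Section Probability.
Context (R : realType) (disp : measure_display) (T : measurableType disp)
  (P : probability T R).
Implicit Types A B : set T.

Lemma PrE A : measurable A -> P A = (Pr P A)%:E.
Proof. by move=> mA; rewrite /Pr fineK // fin_num_measure. Qed.

Lemma Pr_ge0 A : 0 <= Pr P A.
Proof. by rewrite /Pr fine_ge0. Qed.

Lemma Pr_le A B : measurable A -> measurable B -> A `<=` B ->
  Pr P A <= Pr P B.
Proof.
move=> mA mB AB; rewrite -lee_fin -!PrE //.
by apply: le_measure; rewrite ?inE.
Qed.

Lemma PrT : Pr P [set: T] = 1.
Proof. by rewrite /Pr probability_setT. Qed.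

Lemma Pr_le1 A : measurable A -> Pr P A <= 1.
Proof. by move=> mA; rewrite -PrT; apply: Pr_le. Qed.

Lemma PrU A B : measurable A -> measurable B ->
  Pr P (A `|` B) <= Pr P A + Pr P B.
Proof.
move=> mA mB; rewrite -lee_fin EFinD -!PrE //; last exact: measurableU.
exact: measureU2.
Qed.

Lemma PrC A : measurable A -> Pr P (~` A) = 1 - Pr P A.
Proof.
move=> mA; apply: EFin_inj.
rewrite EFinB -!PrE //; last exact: measurableC.
by rewrite probability_setC.
Qed.

Lemma Pr_bigsetU (I : Type) (s : seq I) (Q : pred I) (A : I -> set T) :
  (forall i, measurable (A i)) ->
  Pr P (\big[setU/set0]_(i <- s | Q i) A i) <= \sum_(i <- s | Q i) Pr P (A i).
Proof.
move=> mA.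
(* Measurability is carried along the induction, since binary subadditivity asks for it. *)
suff [] : measurable (\big[setU/set0]_(i <- s | Q i) A i) /\
  Pr P (\big[setU/set0]_(i <- s | Q i) A i) <= \sum_(i <- s | Q i) Pr P (A i) by [].
apply: (big_ind2 (fun B r => measurable B /\ Pr P B <= r)) => [|B r C q|i _].
- by rewrite /Pr measure0.
- move=> [mB Br] [mC Cq]; split; first exact: measurableU.
  by apply: (le_trans (PrU mB mC)); apply: lerD.
- by [].
Qed.

Lemma measurable_RV_le (Y : {RV P >-> R}) (x : R) :
  measurable [set w | Y w <= x].
Proof.
rewrite -[X in measurable X]setTI.
have -> : [set w | Y w <= x] = Y @^-1` `]-oo, x].
  by apply/seteqP; split => w /=; rewrite in_itv.
by apply: (measurable_funPT Y) => //.
Qed.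

Lemma measurable_RV_lt (Y : {RV P >-> R}) (x : R) :
  measurable [set w | Y w < x].
Proof.
rewrite -[X in measurable X]setTI.
have -> : [set w | Y w < x] = Y @^-1` `]-oo, x[.
  by apply/seteqP; split => w /=; rewrite in_itv.
by apply: (measurable_funPT Y) => //.
Qed.

Lemma RV_leC (Y : {RV P >-> R}) (x : R) :
  [set w | x < Y w] = ~` [set w | Y w <= x].
Proof. by apply/seteqP; split => w /=; rewrite ltNge => /negP. Qed.

Lemma cdf_Pr (Y : {RV P >-> R}) (x : R) :
  fine (cdf Y x) = Pr P [set w | Y w <= x].
Proof.
rewrite /cdf /Pr /distribution /pushforward.
by congr (fine (P _)); apply/seteqP; split => w /=; rewrite in_itv.
Qed.

Lemma fine_cdf_homo (Y : {RV P >-> R}) :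
  {homo (fun x => fine (cdf Y x)) : x y / x <= y}.
Proof.
move=> x y xy; rewrite !cdf_Pr; apply: Pr_le => [||w /= /le_trans].
- exact: measurable_RV_le.
- exact: measurable_RV_le.
- exact.
Qed.

End Probability.

(** * Maxima over boxes, expressed through finitely many exceedance events *)

Section Field.
Context (R : realType) (d : nat) (disp : measure_display)
  (T : measurableType disp) (P : probability T R).
Variable X : {ffun 'I_d -> int} -> {RV P >-> R}.
Implicit Types p q : {ffun 'I_d -> nat}.

(** Indexes the lattice points of a large cube by a finite type, so that suprema become finite
    unions. The successor appears because boxes start at 1. *)
Definition cell (N : nat) (f : {ffun 'I_d -> 'I_N.+1}) : {ffun 'I_d -> int} :=
  zvec (fun i => (f i).+1).

Definition inbox (N : nat) p (f : {ffun 'I_d -> 'I_N.+1}) : bool :=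
  [forall i, (f i < p i)%N].

Lemma card_inbox N p : (forall i, p i <= N.+1)%N ->
  #|[pred f : {ffun 'I_d -> 'I_N.+1} | inbox p f]| = vol p.
Proof.
move=> pN; pose F i := [pred j : 'I_N.+1 | (j < p i)%N].
rewrite (@eq_card _ _ (family F)); last first.
  by move=> f; rewrite !inE; apply: eq_forallb => i.
rewrite card_family foldrE big_image /= /vol; apply: eq_bigr => i _.
rewrite -sum1_card (eq_bigl (fun j : 'I_N.+1 => (j < p i)%N)) //.
by rewrite -(big_ord_widen _ (fun=> 1%N) (pN i)) sum1_card card_ord.
Qed.

(** The bound [N] is left free so that two boxes can be described over one common index type. *)
Lemma PM_setE N p x : (forall i, p i <= N.+1)%N ->
  [set w | (M X (zvec p) w <= x%:E)%E] =
  ~` \big[setU/set0]_(f : {ffun 'I_d -> 'I_N.+1} | inbox p f)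
       [set w | x < X (cell f) w].
Proof.
move=> pN; rewrite -bigcup_seq_cond; apply/seteqP; split => w /=.
  move=> Mx [f /= /andP[_ /forallP fp]]; apply/negP; rewrite -leNgt -lee_fin.
  apply: le_trans Mx; apply: ereal_sup_ubound; exists (cell f) => //= i.
  by rewrite !ffunE lez_nat fp.
move=> H; apply: ge_ereal_sup => _ [k /= kp <-]; rewrite lee_fin leNgt.
apply/negP => xk; apply: H.
(* Shifting each coordinate of [k] down by one inverts [cell]; the bounds on [k] make [inord]
   exact. *)
exists [ffun i => inord (`|k i|%N.-1)] => /=.
  rewrite mem_index_enum; apply/forallP => i; rewrite ffunE inordK.
    by have := kp i; rewrite ffunE; move: (pN i); lia.
  by have := kp i; rewrite ffunE; move: (pN i); lia.
suff -> : cell [ffun i => inord `|k i|.-1 : 'I_N.+1] = k by [].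
apply/ffunP => i; rewrite !ffunE inordK.
  have /andP[k1 _] := kp i; rewrite prednK ?gez0_abs //; first by rewrite (le_trans _ k1).
  by move: (k i) k1 => z; lia.
by have := kp i; rewrite ffunE; move: (pN i); lia.
Qed.

Lemma exists_bound p : exists N, forall i, (p i <= N.+1)%N.
Proof.
by exists (\max_i p i)%N => i; rewrite leqW //; apply: leq_bigmax.
Qed.

Lemma measurable_PM p x : measurable [set w | (M X (zvec p) w <= x%:E)%E].
Proof.
have [N pN] := exists_bound p; rewrite (PM_setE _ pN).
apply: measurableC; apply: bigsetU_measurable => f _.
by rewrite RV_leC; apply: measurableC; apply: measurable_RV_le.
Qed.

Lemma PM_ge0 p x : 0 <= PM X (zvec p) x.
Proof. exact: Pr_ge0. Qed.

Lemma PM_le1 p x : PM X (zvec p) x <= 1.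
Proof. exact/Pr_le1/measurable_PM. Qed.

Lemma PM_homo p x y : x <= y -> PM X (zvec p) x <= PM X (zvec p) y.
Proof.
move=> xy; apply: Pr_le => [||w /=]; try exact: measurable_PM.
by move=> /le_trans; apply; rewrite lee_fin.
Qed.

Lemma PM_eq1 p x i : p i = 0%N -> PM X (zvec p) x = 1.
Proof.
move=> pi0; have [N pN] := exists_bound p; rewrite /PM (PM_setE _ pN) big1.
  by rewrite setC0 PrT.
by move=> f /forallP/(_ i); rewrite pi0.
Qed.

Lemma PM_antimono p q x : (forall i, p i <= q i)%N ->
  PM X (zvec q) x <= PM X (zvec p) x.
Proof.
move=> pq; apply: Pr_le => [||w /=]; try exact: measurable_PM.
apply: le_trans; apply: ereal_sup_le => _ [k /= kp <-]; exists k => //= i.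
have /andP[-> kpi] := kp i; apply: (le_trans kpi).
by rewrite !ffunE lez_nat.
Qed.

Hypothesis hX : stationary X.

Lemma stationary_cdf k x : Pr P [set w | X k w <= x] = margF X x.
Proof.
rewrite /margF cdf_Pr /Pr; congr fine.
(* Stationarity for a single site: the one-point tuple at the origin, shifted by [k]. *)
have /(_ [set t | tnth t ord0 <= x]) H := hX [tuple of [:: 0]] k.
have E z : [set w | [set t : 1.-tuple R | tnth t ord0 <= x]
   [tuple X (tnth [tuple of [:: 0]] j + z) w | j < 1]] = [set w | X z w <= x].
  by apply/seteqP; split => w /=; rewrite !(tnth_mktuple, tnth0) add0r.
rewrite -E H.
  congr (P _); apply/seteqP; split => w /=; rewrite !(tnth_mktuple, tnth0) //.
rewrite -[X in measurable X]setTI.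
have -> : [set t : 1.-tuple R | tnth t ord0 <= x] =
    (@tnth 1 R)^~ ord0 @^-1` `]-oo, x].
  by apply/seteqP; split => w /=; rewrite in_itv.
exact: measurable_tnth.
Qed.

(** The two events differ only if some site of [q] outside [p] exceeds [x]. There are
    [vol q - vol p] such sites, each exceeding with probability [1 - margF X x]. *)
Lemma PM_lip p q x : (forall i, p i <= q i)%N ->
  PM X (zvec p) x - PM X (zvec q) x <=
  ((vol q)%:R - (vol p)%:R) * (1 - margF X x).
Proof.
move=> pq; have [N qN] := exists_bound q.
have pN i : (p i <= N.+1)%N by rewrite (leq_trans (pq i)).
pose D := \big[setU/set0]_(f : {ffun 'I_d -> 'I_N.+1} | inbox q f && ~~ inbox p f)
   [set w | x < X (cell f) w].
have mA (f : {ffun 'I_d -> 'I_N.+1}) : measurable [set w | x < X (cell f) w].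
  by rewrite RV_leC; apply: measurableC; apply: measurable_RV_le.
have mD : measurable D by apply: bigsetU_measurable.
have sub : [set w | (M X (zvec p) w <= x%:E)%E] `<=`
    [set w | (M X (zvec q) w <= x%:E)%E] `|` D.
  rewrite (PM_setE _ pN) (PM_setE _ qN) /D -!bigcup_seq_cond => w /= Hp.
  have [[f /= Hf xf]|Hq] := pselect ((\bigcup_(i in [set i | (i \in
      index_enum {ffun 'I_d -> 'I_N.+1}) && inbox q i]) [set w | x < X (cell i) w]) w);
    [right|by left].
  exists f => //=; case/andP: Hf => -> -> /=.
  apply/negP => fp; apply: Hp; exists f => //=.
  by rewrite mem_index_enum.
rewrite lerBlDl.
have mq := measurable_PM q x.
apply: (le_trans (Pr_le P (measurable_PM p x) (measurableU _ _ mq mD) sub)).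
apply: (le_trans (PrU P mq mD)); rewrite lerD2l.
apply: (le_trans (Pr_bigsetU P _ _ mA)).
rewrite (eq_bigr (fun=> 1 - margF X x)); last first.
  move=> f _; rewrite RV_leC PrC ?stationary_cdf //.
  exact: measurable_RV_le.
rewrite sumr_const -[X in X <= _]mulr_natl; apply: ler_wpM2r.
  by rewrite -(stationary_cdf 0) subr_ge0 Pr_le1 //; exact: measurable_RV_le.
rewrite -(card_inbox qN) -(card_inbox pN).
rewrite -(cardID [pred f | inbox p f] [pred f | inbox q f]) natrD addrAC.
rewrite (@eq_card _ [predI _ & _] [pred f | inbox p f]); last first.
  move=> f; rewrite !inE; apply/andP/idP => [[]//|fp]; split => //.
  by apply/forallP => i; rewrite (leq_trans _ (pq i)) //; move/forallP : fp.
rewrite subrr add0r ler_nat eq_leq //; apply: eq_card => f; rewrite !inE.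
by rewrite andbC.
Qed.

Lemma margF_ge0 x : 0 <= margF X x.
Proof. by rewrite /margF cdf_Pr Pr_ge0. Qed.

Lemma margF_le1 x : margF X x <= 1.
Proof. by rewrite /margF cdf_Pr Pr_le1 //; exact: measurable_RV_le. Qed.

Lemma margF_homo : {homo margF X : x y / x <= y}.
Proof. exact: fine_cdf_homo. Qed.

Lemma PM_ge_union p x : (0 < d)%N ->
  1 - PM X (zvec p) x <= (vol p)%:R * (1 - margF X x).
Proof.
(* Comparison with the box of side 0, which is empty because [0 < d] and so has probability 1. *)
move=> d0; have := @PM_lip [ffun=> 0%N] p x.
rewrite (@PM_eq1 _ x (Ordinal d0)) ?ffunE // => /(_ _)/le_trans; apply.
  by move=> i; rewrite ffunE.
apply: ler_wpM2r; first by rewrite subr_ge0 margF_le1.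
by rewrite lerBlDr lerDl.
Qed.

End Field.

(** * Lipschitz estimates for products, powers, roots and exponentials *)

Section Estimates.
Variable R : realType.
Implicit Types (x y e : R) (n : nat).

(** The factors are exchanged one at a time; each exchange costs the difference of two factors times
    a product of others bounded by [B], and [1 <= B] allows the common bound [B ^+ #|I|]. *)
Lemma prod_lip (I : finType) (B : R) (x y : I -> R) : 1 <= B ->
  (forall i, 0 <= x i <= B) -> (forall i, 0 <= y i <= B) ->
  `|\prod_i x i - \prod_i y i| <= B ^+ #|I| * \sum_i `|x i - y i|.
Proof.
move=> B1 hx hy; have B0 : 0 <= B by exact: le_trans B1.
have -> : #|I| = size (index_enum I) by rewrite cardT enumT /index_enum unlock.
elim: (index_enum I) => [|i s IH].
  by rewrite !big_nil subrr normr0 mulr0.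
rewrite !big_cons mulrDr.
set px := \prod_(j <- s) _; set py := \prod_(j <- s) _; set z := \sum_(j <- s) _.
have px0 : 0 <= px by apply: prodr_ge0 => j _; case/andP: (hx j).
have pxB : px <= B ^+ size s.
  rewrite /px; elim: (s) => [|j r IHr]; first by rewrite big_nil.
  rewrite big_cons exprS; have /andP[? ?] := hx j; apply: ler_pM => //.
  by apply: prodr_ge0 => l _; case/andP: (hx l).
have /andP[y00 y0B] := hy i.
have -> : x i * px - y i * py = (x i - y i) * px + y i * (px - py) by ring.
apply: (le_trans (ler_normD _ _)); rewrite !normrM (ger0_norm px0) (ger0_norm y00).
apply: lerD.
  rewrite mulrC; apply: ler_wpM2r => //; apply: (le_trans pxB).
  by rewrite exprS ler_peMl // exprn_ge0.
by rewrite exprS -mulrA; apply: ler_pM.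
Qed.

Lemma prod_lip_unif n (B e : R) (x y : 'I_n -> R) : 1 <= B ->
  (forall i, 0 <= x i <= B) -> (forall i, 0 <= y i <= B) ->
  (forall i, `|x i - y i| <= e) ->
  `|\prod_i x i - \prod_i y i| <= B ^+ n * n%:R * e.
Proof.
move=> B1 hx hy he; apply: (le_trans (prod_lip B1 hx hy)).
rewrite card_ord -mulrA; apply: ler_wpM2l; first by rewrite exprn_ge0 // (le_trans _ B1).
apply: (@le_trans _ _ (\sum_(i < n) e)); first exact: ler_sum.
by rewrite sumr_const card_ord mulr_natl.
Qed.

Lemma expr_lip x y n : 0 <= x <= 1 -> 0 <= y <= 1 ->
  `|x ^+ n - y ^+ n| <= n%:R * `|x - y|.
Proof.
move=> hx hy; have := @prod_lip_unif n 1 `|x - y| (fun=> x) (fun=> y) (lexx _).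
by rewrite !prodr_const card_ord expr1n mul1r; apply.
Qed.

(** In the factorisation of the difference of powers, the cofactor of [x - y] is a sum of
    non-negative terms, one of which is [y ^+ n]. This transfers convergence of powers to their
    roots. *)
Lemma root_lip x y n : 0 <= x -> 0 < y ->
  `|x - y| <= `|x ^+ n.+1 - y ^+ n.+1| / y ^+ n.
Proof.
move=> x0 y0; rewrite ler_pdivlMr ?exprn_gt0 // subrXX normrM.
apply: ler_wpM2l => //; rewrite big_ord_recr /= subnn expr0 mul1r.
apply: le_trans (ler_norm _); rewrite lerDr; apply: sumr_ge0 => i _.
by rewrite mulr_ge0 // exprn_ge0 // ltW.
Qed.

Lemma expRN_lip x y : 0 <= x -> 0 <= y ->
  `|expR (- x) - expR (- y)| <= `|x - y|.
Proof.
wlog xy : x y / x <= y => [H|x0 y0].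
  have [xy|/ltW yx] := leP x y; first exact: H.
  by move=> x0 y0; rewrite distrC (distrC x); apply: H.
rewrite ger0_norm; last by rewrite subr_ge0 ler_expR lerN2.
rewrite distrC ger0_norm ?subr_ge0 //.
have -> : - y = - x + - (y - x) by ring.
rewrite expRD -[X in X - _]mulr1 -mulrBr.
have e1 : expR (- x) <= 1 by rewrite -expR0 ler_expR oppr_le0.
have e2 : 1 - expR (- (y - x)) <= y - x.
  by have := expR_ge1Dx (- (y - x)); lra.
have e3 : 0 <= 1 - expR (- (y - x)).
  by rewrite subr_ge0 -expR0 ler_expR oppr_le0 subr_ge0.
by apply: le_trans e2; rewrite ler_piMl.
Qed.

(** Blocks of length [q] are split off one at a time. Each split costs [e], and the factor
    [h q <= 1] does not enlarge the error accumulated so far. *)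
Lemma almost_additive_iter (h : nat -> R) (B q a : nat) e :
  (forall m, 0 <= h m <= 1) -> h 0%N = 1 ->
  (forall m n, (m + n <= B)%N -> `|h (m + n)%N - h m * h n| <= e) ->
  (a * q <= B)%N -> `|h (a * q)%N - h q ^+ a| <= a%:R * e.
Proof.
move=> h01 h0 hadd; elim: a => [|a IH] aB.
  by rewrite mul0n expr0 h0 subrr normr0 mul0r.
have aB' : (a * q <= B)%N by lia.
rewrite mulSn exprS.
have -> : h (q + a * q)%N - h q * h q ^+ a =
  (h (q + a * q)%N - h q * h (a * q)%N) + h q * (h (a * q)%N - h q ^+ a) by ring.
apply: (le_trans (ler_normD _ _)); rewrite -natr1 mulrDl mul1r addrC.
apply: lerD; last by apply: hadd; rewrite -mulSn.
have /andP[hq0 hq1] := h01 q.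
rewrite normrM (ger0_norm hq0); apply: le_trans (IH aB').
by rewrite ler_piMl.
Qed.

End Estimates.

(** * Cutting a box into equal cubes under an almost multiplicative function *)

Section Multiplicative.
Context (R : realType) (d : nat).
Implicit Types p a : {ffun 'I_d -> nat}.

Definition upd p (i : 'I_d) (m : nat) : {ffun 'I_d -> nat} :=
  [ffun j => if j == i then m else p j].

(** The sides are lengthened one at a time from [q] to [a i * q]. Raising to the power [a i <= A]
    multiplies the accumulated error by at most [A], and the new cuts add at most [A * e]. *)
Lemma almost_multiplicative_box (g : {ffun 'I_d -> nat} -> R) (B q A : nat)
    (e : R) a :
  (forall p, 0 <= g p <= 1) ->
  (forall p i, p i = 0%N -> g p = 1) ->
  (forall p i m n, (forall j, upd p i (m + n) j <= B)%N ->
     `|g (upd p i (m + n)) - g (upd p i m) * g (upd p i n)| <= e) ->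
  (0 < A)%N -> (forall i, a i <= A)%N ->
  (q <= B)%N -> (forall i, a i * q <= B)%N ->
  `|g [ffun i => (a i * q)%N] - g (Delta d q) ^+ vol a|
    <= d%:R * A%:R ^+ d * e.
Proof.
move=> g01 g1 hadd A0 aA qB aqB.
have [d0|d0] := posnP d.
  have -> : vol a = 1%N.
    by rewrite /vol big1 // => i; have := ltn_ord i; lia.
  have -> : [ffun i => (a i * q)%N] = Delta d q.
    by apply/ffunP => i; have := ltn_ord i; lia.
  by rewrite expr1 subrr normr0 d0 !mul0r.
(* The zero box, cut into two empty pieces, satisfies the hypothesis, which forces this sign. *)
have e0 : 0 <= e.
  apply: (le_trans (normr_ge0 _)).
  apply: (hadd [ffun=> 0%N] (Ordinal d0) 0%N 0%N) => j.
  by rewrite !ffunE addn0; case: ifP.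
(* The first [j] sides have reached their final length and the others are still [q]; [vj j] counts
   the cubes of side [q] in this intermediate box. *)
pose pj (j : nat) : {ffun 'I_d -> nat} :=
  [ffun i : 'I_d => if (i < j)%N then (a i * q)%N else q].
pose vj (j : nat) := (\prod_(i < d | (i < j)%N) a i)%N.
have A1 : 1 <= A%:R :> R by rewrite ler1n.
suff H j : (j <= d)%N -> `|g (pj j) - g (Delta d q) ^+ vj j| <= j%:R * A%:R ^+ j * e.
  have := H d (leqnn _).
  have -> : pj d = [ffun i => (a i * q)%N] by apply/ffunP => i; rewrite !ffunE ltn_ord.
  suff -> : vj d = vol a by [].
  by apply: eq_bigl => i; rewrite ltn_ord.
elim: j => [_|j IH jd].
  rewrite /vj big_pred0; last by move=> i; rewrite ltn0.
  have -> : pj 0%N = Delta d q by apply/ffunP => i; rewrite !ffunE.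
  by rewrite expr1 subrr normr0 !mul0r.
pose i0 := Ordinal jd.
have pjS : pj j.+1 = upd (pj j) i0 (a i0 * q)%N.
  apply/ffunP => i; rewrite !ffunE ltnS leq_eqVlt -val_eqE /=.
  by case: eqP => //= ij; congr ((a _) * _)%N; apply: val_inj.
have pjj : pj j = upd (pj j) i0 q.
  by apply/ffunP => i; rewrite !ffunE -val_eqE /=; case: eqP => // ->; rewrite ltnn.
have vjS : vj j.+1 = (vj j * a i0)%N.
  rewrite /vj (bigD1 i0) //= mulnC; congr muln; apply: eq_bigl => i.
  by rewrite ltnS ltn_neqAle -val_eqE andbC.
have pjB i m : (m <= B)%N -> (upd (pj j) i0 m i <= B)%N.
  by rewrite !ffunE => mB; case: ifP => // _; case: ifP.
have s1 : `|g (pj j.+1) - g (pj j) ^+ a i0| <= (a i0)%:R * e.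
  rewrite pjS [in X in _ - X]pjj.
  apply: (@almost_additive_iter R (fun m => g (upd (pj j) i0 m)) B) => //.
    by apply: (g1 _ i0); rewrite ffunE eqxx.
  by move=> m n mn; apply: hadd => i; apply: pjB.
have gD := g01 (Delta d q).
have s2 : `|g (pj j) ^+ a i0 - (g (Delta d q) ^+ vj j) ^+ a i0|
    <= (a i0)%:R * (j%:R * A%:R ^+ j * e).
  apply: (le_trans (expr_lip _ (g01 _) _)).
    by case/andP: gD => ? ?; rewrite exprn_ge0 // exprn_ile1.
  by apply: ler_wpM2l => //; apply: IH; exact: ltnW.
have aA' : (a i0)%:R <= A%:R :> R by rewrite ler_nat.
have A0' : 0 <= A%:R :> R by [].
rewrite vjS exprM.
have -> : g (pj j.+1) - (g (Delta d q) ^+ vj j) ^+ a i0 =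
   (g (pj j.+1) - g (pj j) ^+ a i0) +
   (g (pj j) ^+ a i0 - (g (Delta d q) ^+ vj j) ^+ a i0) by ring.
apply: (le_trans (ler_normD _ _)).
rewrite -natr1 !mulrDl mul1r addrC; apply: lerD.
  apply: (le_trans s2); rewrite exprS.
  have -> : j%:R * (A%:R * A%:R ^+ j) * e = A%:R * (j%:R * A%:R ^+ j * e) by ring.
  by apply: ler_wpM2r => //; rewrite mulr_ge0 // mulr_ge0 // exprn_ge0.
apply: (le_trans s1); apply: ler_wpM2r => //; apply: (le_trans aA').
by rewrite exprS ler_peMr // exprn_ege1.
Qed.

End Multiplicative.

(** * A single cut controlled by the mixing coefficient *)

Section BetaSplit.
Context (R : realType) (d : nat) (disp : measure_display)
  (T : measurableType disp) (P : probability T R).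
Variables (X : {ffun 'I_d -> int} -> {RV P >-> R}) (v : nat -> R).

(** In [beta], let p(1) be the box with side [a] in direction [i], and let p(2) have side [b] in
    direction [i] and 0 in all others. This isolates one cut. *)
Lemma beta_split (t n : nat) p (i : 'I_d) (a b : nat) :
  (forall j, upd p i (a + b) j <= t * n)%N ->
  `|PM X (zvec (upd p i (a + b))) (v n) -
    PM X (zvec (upd p i a)) (v n) * PM X (zvec (upd p i b)) (v n)|
    <= beta X v t%:R n.
Proof.
(* [t] is a natural number here, so the truncation inside [beta] is exact. *)
move=> pB; rewrite /beta -natrM natrK.
have pB' (m : nat) j : (m <= a + b)%N -> (upd p i m j <= t * n)%N.
  by have := pB j; rewrite !ffunE; case: ifP => // _; lia.
pose p1 : {ffun 'I_d -> 'I_(t * n).+1} := [ffun j => inord (upd p i a j)].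
pose p2 : {ffun 'I_d -> 'I_(t * n).+1} := [ffun j => inord (if j == i then b else 0%N)].
have p1E j : p1 j = upd p i a j :> nat.
  by rewrite [p1 j]ffunE inordK // ltnS; apply: pB'; lia.
have p2E j : p2 j = (if j == i then b else 0%N) :> nat.
  rewrite [p2 j]ffunE inordK // ltnS; case: ifP => // /eqP _.
  by have := pB i; rewrite ffunE eqxx; lia.
clearbody p1 p2.
have sumE j : (p1 j + p2 j)%N = upd p i (a + b) j.
  by rewrite p1E p2E !ffunE; case: ifP => // _; rewrite addn0.
have := @le_bigmax_cond _ R ({ffun 'I_d -> 'I_(t * n).+1} *
  {ffun 'I_d -> 'I_(t * n).+1})%type 0 (p1, p2)
  (fun p => [forall l, (p.1 l + p.2 l)%N%:R <= (t * n)%:R :> R])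
  (fun p => `| PM X (zvec (fun l => p.1 l + p.2 l)%N) (v n)
       - \prod_(i : {ffun 'I_d -> bool})
           PM X (zvec (fun l => if i l then p.2 l : nat else p.1 l : nat)) (v n) |).
move=> /(_ _) H; apply: le_trans (H _); last first.
  by apply/forallP => j /=; rewrite ler_nat sumE.
rewrite /= le_eqVlt; apply/orP; left; apply/eqP.
congr `| _ - _|.
  by congr (PM X _ _); apply/ffunP => j; rewrite !ffunE sumE !ffunE.
(* [s0] takes every side from [p1], and [s1] takes only side [i] from [p2]. Any other choice takes a
   side of length 0 from [p2], so its factor is 1. *)
pose s0 : {ffun 'I_d -> bool} := [ffun=> false].
pose s1 : {ffun 'I_d -> bool} := [ffun j => j == i].
have s10 : s1 != s0.
  by apply/eqP => /ffunP/(_ i); rewrite !ffunE eqxx.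
rewrite (bigD1 s0) //= (bigD1 s1) //= big1 ?mulr1.
  congr (PM X _ _ * PM X _ _); apply/ffunP => j.
    by rewrite !ffunE p1E ffunE.
  by rewrite !ffunE p1E p2E !ffunE; case: ifP.
move=> s /andP[ss0 ss1].
have [j ji sj] : exists2 j, j != i & s j.
  apply: contrapT => H'.
  have sF j : j != i -> s j = false.
    by move=> ji; apply/negP => sj; apply: H'; exists j.
  case si : (s i).
    move/negP : ss1; apply; apply/eqP/ffunP => j; rewrite ffunE.
    by case: eqVneq => [->//|/sF].
  move/negP : ss0; apply; apply/eqP/ffunP => j; rewrite ffunE.
  by case: (eqVneq j i) => [->//|/sF].
have -> : zvec (fun l => if s l then p2 l : nat else p1 l : nat) =
  zvec [ffun l => if s l then p2 l : nat else p1 l : nat].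
  by apply/ffunP => l; rewrite !ffunE.
by apply: (@PM_eq1 _ _ _ _ _ _ _ _ j); rewrite ffunE sj p2E (negbTE ji).
Qed.

End BetaSplit.

(** * Limits, integer bounds and grid arithmetic *)

Lemma cvg_near_dist (R : realType) (u : nat -> R) (l e : R) :
  u n @[n --> \oo] --> l -> 0 < e -> \forall n \near \oo, `|u n - l| <= e.
Proof.
by move=> /cvgrPdist_le/(_ e) h e0; apply: filterS (h e0) => n; rewrite distrC.
Qed.

Lemma nat_above (R : realType) (x : R) : exists2 k, (0 < k)%N & x <= k%:R.
Proof.
exists (Num.bound x).+1 => //.
have [x0|/ltW x0] := leP 0 x; last by rewrite (le_trans x0).
by apply: ltW; apply: (lt_trans (archi_boundP x0)); rewrite ltr_nat.
Qed.

Lemma grid_le_double (n q k : nat) :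
  (0 < q)%N -> (n < q * k + k)%N -> (n <= 2 * (q * k))%N.
Proof. nia. Qed.

(** Division-free form of |p/n - a/k| <= 1/k, where [q] is the integer part of [n / k] and [a * q]
    approximates [p] from below within [q]. *)
Lemma grid_error (n q k a p : nat) : (q * k <= n)%N -> (n < q * k + k)%N ->
  (a * q <= p)%N -> (p <= a * q + q)%N -> (a * k <= n)%N ->
  (p * k <= n + a * n)%N && (a * n <= n + p * k)%N.
Proof.
move=> qk qk' ap pa an.
have h1 : (p * k <= (a * q + q) * k)%N by rewrite leq_mul2r pa orbT.
have h2 : (a * n <= a * (q * k + k))%N by rewrite leq_mul2l (ltnW qk') orbT.
have h3 : (a * (q * k) <= a * n)%N by rewrite leq_mul2l qk orbT.
have h4 : (a * q * k <= p * k)%N by rewrite leq_mul2r ap orbT.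
by apply/andP; split; lia.
Qed.

(** * Volumes of boxes *)

Section Volume.
Context (R : realType) (d : nat).
Implicit Types p : {ffun 'I_d -> nat}.

Lemma vol_ratio n p : (vol p)%:R / n%:R ^+ d = \prod_i ((p i)%:R / n%:R) :> R.
Proof. by rewrite /vol natr_prod big_split /= prodr_const card_ord exprVn. Qed.

Lemma vol_le_exp p (A : nat) : (forall i, p i <= A)%N -> (vol p <= A ^ d)%N.
Proof.
move=> pA; rewrite /vol -[d in (A ^ d)%N]card_ord -prod_nat_const.
exact: leq_prod.
Qed.

Lemma vol_Delta n : vol (Delta d n) = (n ^ d)%N.
Proof.
rewrite /vol (eq_bigr (fun=> n)); first by rewrite prod_nat_const card_ord.
by move=> i _; rewrite ffunE.
Qed.

End Volume.

(** * Insensitivity of the maximum to small changes of a box at high levels *)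

Section Scaling.
Context (R : realType) (d : nat) (disp : measure_display)
  (T : measurableType disp) (P : probability T R).
Variables (X : {ffun 'I_d -> int} -> {RV P >-> R}).
Hypothesis hX : stationary X.
Implicit Types p q : {ffun 'I_d -> nat}.

(** By [PM_lip] the difference is at most [L] times the change of the normalised volume [vol / n^d].
    That volume is a product of ratios in [[0, t]], each changing by at most [m / n]. *)
Lemma PM_lip_scaled (n t m : nat) (x L : R) p q : (0 < n)%N -> (0 < t)%N ->
  n%:R ^+ d * (1 - margF X x) <= L ->
  (forall i, p i <= q i)%N -> (forall i, q i <= t * n)%N ->
  (forall i, q i <= p i + m)%N ->
  `|PM X (zvec p) x - PM X (zvec q) x| <= L * (t%:R ^+ d * d%:R * (m%:R / n%:R)).
Proof.
move=> n0 t0 hL pq qt qm; have n0' : 0 < n%:R :> R by rewrite ltr0n.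
rewrite ger0_norm ?subr_ge0; last exact: PM_antimono.
apply: (le_trans (PM_lip hX _ pq)).
have w0 : 0 <= 1 - margF X x by rewrite subr_ge0 margF_le1.
have -> : ((vol q)%:R - (vol p)%:R) * (1 - margF X x) = n%:R ^+ d * (1 - margF X x) *
   ((vol q)%:R / n%:R ^+ d - (vol p)%:R / n%:R ^+ d).
  by field; rewrite expf_neq0 // gt_eqF.
have bnd (r : {ffun 'I_d -> nat}) i : (r i <= t * n)%N ->
    0 <= (r i)%:R / n%:R <= (t%:R : R).
  move=> rt; rewrite divr_ge0 //=.
  by rewrite ler_pdivrMr // -natrM ler_nat.
have H : `|(vol q)%:R / n%:R ^+ d - (vol p)%:R / n%:R ^+ d|
    <= t%:R ^+ d * d%:R * (m%:R / n%:R) :> R.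
  rewrite !vol_ratio; apply: prod_lip_unif => [|i|i|i].
  - by rewrite ler1n.
  - exact: bnd.
  - by apply: bnd; apply: leq_trans (pq i) (qt i).
  - rewrite -mulrBl normrM (ger0_norm (x := n%:R^-1)) ?invr_ge0 //.
    apply: ler_wpM2r; first by rewrite invr_ge0.
    by rewrite -natrB // normr_nat ler_nat leq_subLR.
have H0 : 0 <= n%:R ^+ d * (1 - margF X x) by rewrite mulr_ge0 // exprn_ge0.
apply: (le_trans (ler_wpM2l H0 (le_trans (ler_norm _) H))).
by apply: ler_wpM2r => //; apply: le_trans H.
Qed.

End Scaling.

(** * Asymptotics of the maximum over boxes along the levels *)

Section LevelAsymptotics.
Context (R : realType) (d : nat) (disp : measure_display)
  (T : measurableType disp) (P : probability T R).
Variables (X : {ffun 'I_d -> int} -> {RV P >-> R}) (v : nat -> R) (gor L : R).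
Hypothesis hX : stationary X.
Implicit Types p q : {ffun 'I_d -> nat}.
Hypothesis gor0 : 0 < gor.
Hypothesis gor1 : gor <= 1.
Hypothesis hgor : PM X (zvec (Delta d n)) (v n) @[n --> \oo] --> gor.
Hypothesis L0 : 0 < L.
Hypothesis hL : \forall n \near \oo, n%:R ^+ d * (1 - margF X (v n)) <= L.
Hypothesis hbeta : forall t : R, 0 < t -> beta X v t n @[n --> \oo] --> (0 : R).

Lemma beta_near (t : nat) (e : R) : (0 < t)%N -> 0 < e ->
  \forall n \near \oo, beta X v t%:R n <= e.
Proof.
move=> t0 e0; have t0' : 0 < t%:R :> R by rewrite ltr0n.
apply: filterS (cvg_near_dist (hbeta t0') e0) => n.
by rewrite subr0; apply: le_trans; exact: ler_norm.
Qed.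

Lemma PM_box (n t q A : nat) (a : {ffun 'I_d -> nat}) : (0 < A)%N ->
  (forall i, a i <= A)%N -> (q <= t * n)%N -> (forall i, a i * q <= t * n)%N ->
  `|PM X (zvec [ffun i => (a i * q)%N]) (v n) -
    PM X (zvec (Delta d q)) (v n) ^+ vol a| <= d%:R * A%:R ^+ d * beta X v t%:R n.
Proof.
move=> A0 aA qB aqB.
apply: (almost_multiplicative_box (g := fun p => PM X (zvec p) (v n))
  (B := t * n)) => //.
- by move=> p; rewrite PM_ge0 PM_le1.
- by move=> p i; exact: PM_eq1.
- by move=> p i m m' H; apply: beta_split.
Qed.

(** Up to a negligible remainder, the cube of side [n] consists of [k^d] cubes of side [n %/ k]. The
    [k^d]-th power of their common probability thus tends to [gor], and [root_lip] extracts the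
    root. *)
Lemma PM_subcube_cvg (k : nat) : (0 < k)%N ->
  PM X (zvec (Delta d (n %/ k))) (v n) @[n --> \oo] -->
    expR (- (- ln gor / k%:R ^+ d)).
Proof.
move=> k0; set y := expR _.
have y0 : 0 < y by exact: expR_gt0.
have [K KE] : exists K, (k ^ d)%N = K.+1.
  by exists (k ^ d).-1; rewrite prednK // expn_gt0 k0.
have kd0 : k%:R ^+ d != 0 :> R by rewrite expf_neq0 // pnatr_eq0 -lt0n.
have yK : y ^+ K.+1 = gor.
  rewrite -KE /y -expRM_natl.
  have -> : (k ^ d)%:R * - (- ln gor / k%:R ^+ d) = ln gor :> R.
    by rewrite natrX; field.
  by rewrite lnK.
apply/cvgrPdist_le => e e0.
(* One third each for cutting, for the remainder and for the limit [gor]; the factor [y ^+ K] is the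
   loss in [root_lip]. *)
pose e1 := e * y ^+ K / 3.
have e10 : 0 < e1 by rewrite divr_gt0 // mulr_gt0 // exprn_gt0.
pose c : R := d%:R * k%:R ^+ d + 1.
have c0 : 0 < c by rewrite ltr_wpDl // mulr_ge0.
have [N N0 HN] := nat_above (L * (1 ^+ d * d%:R * k%:R) / e1).
near=> n.
have n0 : (0 < n)%N by near: n; exact: nbhs_infty_gt.
have n0' : 0 < n%:R :> R by rewrite ltr0n.
have hb : beta X v 1%:R n <= e1 / c.
  by near: n; apply: beta_near => //; exact: divr_gt0.
have hg : `|PM X (zvec (Delta d n)) (v n) - gor| <= e1.
  by near: n; apply: cvg_near_dist.
have hLn : n%:R ^+ d * (1 - margF X (v n)) <= L by near: n; exact: hL.
have Nn : (N <= n)%N by near: n; exact: nbhs_infty_ge.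
set q := (n %/ k)%N; set z := PM X (zvec (Delta d q)) (v n).
have qk : (q * k <= n)%N by exact: leq_divM.
have qk' : (n < q * k + k)%N by rewrite -mulSnr ltn_ceil.
rewrite distrC; apply: (le_trans (root_lip K (PM_ge0 X (Delta d q) (v n)) y0)).
rewrite ler_pdivrMr ?exprn_gt0 // yK.
have h1 : `|PM X (zvec (Delta d (q * k))) (v n) - z ^+ K.+1| <= e1.
  have := @PM_box n 1 q k (Delta d k) k0.
  have -> : vol (Delta d k) = K.+1 by rewrite vol_Delta.
  have -> : [ffun i => (Delta d k i * q)%N] = Delta d (q * k).
    by apply/ffunP => i; rewrite !ffunE mulnC.
  move=> /(_ _ _ _) H; apply: (le_trans (H _ _ _)).
  - by move=> i; rewrite ffunE.
  - by rewrite mul1n; exact: leq_div.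
  - by move=> i; rewrite ffunE mul1n mulnC.
  - have -> : e1 = c * (e1 / c) by field; rewrite gt_eqF.
    have b0 : 0 <= beta X v 1%:R n by rewrite /beta; apply: bigmax_ge_id.
    have dk0 : 0 <= d%:R * k%:R ^+ d :> R by rewrite mulr_ge0.
    by apply: ler_pM => //; rewrite lerDl.
have h2 : `|PM X (zvec (Delta d (q * k))) (v n) - PM X (zvec (Delta d n)) (v n)| <= e1.
  apply: (le_trans (@PM_lip_scaled _ _ _ _ _ _ hX n 1 k (v n) L _ _
    n0 _ hLn _ _ _)) => //.
  - by move=> i; rewrite !ffunE.
  - by move=> i; rewrite !ffunE mul1n.
  - by move=> i; rewrite !ffunE ltnW.
  - rewrite !mulrA ler_pdivrMr // -ler_pdivrMl //.
    apply: le_trans (_ : N%:R <= _); last by rewrite ler_nat.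
    by apply: le_trans HN; rewrite mulrC !mulrA.
have -> : e * y ^+ K = e1 + e1 + e1 by rewrite /e1; field.
have -> : z ^+ K.+1 - gor = - (PM X (zvec (Delta d (q * k))) (v n) - z ^+ K.+1) +
 (PM X (zvec (Delta d (q * k))) (v n) - PM X (zvec (Delta d n)) (v n)) +
 (PM X (zvec (Delta d n)) (v n) - gor) by ring.
apply: (le_trans (ler_normD _ _)); apply: lerD => //.
by apply: (le_trans (ler_normD _ _)); rewrite normrN; apply: lerD.
Unshelve. all: by end_near.
Qed.

(** Four errors add up: rounding the sides down to multiples of [q = n %/ k], cutting into cubes of
    side [q], replacing the cube probability by its limit [y], and comparing the rounded volume with
    the true one in the exponent. *)
Lemma PM_level_asymptotics (t : nat) (e : R) : (0 < t)%N -> 0 < e ->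
  \forall n \near \oo, forall p, (forall i, p i <= t * n)%N ->
    `|PM X (zvec p) (v n) - expR (- (- ln gor * ((vol p)%:R / n%:R ^+ d)))| <= e.
Proof.
move=> t0 e0; set lam := - ln gor.
have lam0 : 0 <= lam by rewrite /lam oppr_ge0 -ln1 ler_ln ?posrE.
(* [c1 / k] bounds the two rounding errors, in the box and in the exponent; [c2 * e1] below bounds
   the other two. *)
pose c1 : R := L * (t%:R ^+ d * d%:R) + lam * ((2 * t)%:R ^+ d * d%:R).
have [k k0 hk] := nat_above (c1 / (e / 2)).
have k0' : 0 < k%:R :> R by rewrite ltr0n.
(* A side of length at most [t * n] holds at most this many segments of length [q], since
   [n <= 2 * (q * k)]. *)
pose A := (2 * t * k)%N.
have A0 : (0 < A)%N by rewrite !muln_gt0 t0.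
pose c2 : R := d%:R * A%:R ^+ d + A%:R ^+ d + 1.
have c20 : 0 < c2 by rewrite ltr_wpDl // addr_ge0 // ?mulr_ge0 // exprn_ge0.
pose e1 := e / 2 / c2.
have e10 : 0 < e1 by rewrite !divr_gt0.
pose y := expR (- (lam / k%:R ^+ d)).
have y01 : 0 <= y <= 1.
  by rewrite expR_ge0 -expR0 ler_expR oppr_le0 divr_ge0 // exprn_ge0.
near=> n => p pt.
have n0 : (0 < n)%N by near: n; exact: nbhs_infty_gt.
have n0' : 0 < n%:R :> R by rewrite ltr0n.
have kn : (k <= n)%N by near: n; exact: nbhs_infty_ge.
have An : (A * k <= n)%N by near: n; exact: nbhs_infty_ge.
have hb : beta X v t%:R n <= e1 by near: n; apply: beta_near.
have hLn : n%:R ^+ d * (1 - margF X (v n)) <= L by near: n; exact: hL.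
have hq : `|PM X (zvec (Delta d (n %/ k))) (v n) - y| <= e1.
  by near: n; apply: cvg_near_dist e10; exact: PM_subcube_cvg.
set q := (n %/ k)%N in hq *.
have q0 : (0 < q)%N by rewrite divn_gt0.
have qk : (q * k <= n)%N by exact: leq_divM.
have qk' : (n < q * k + k)%N by rewrite -mulSnr ltn_ceil.
have n2 : (n <= 2 * (q * k))%N.
  exact: grid_le_double.
pose a : {ffun 'I_d -> nat} := [ffun i => p i %/ q]%N.
have aq i : (a i * q <= p i)%N by rewrite ffunE leq_divM.
have aq' i : (p i <= a i * q + q)%N by rewrite ffunE -mulSnr ltnW // ltn_ceil.
have aA i : (a i <= A)%N.
  rewrite -(leq_pmul2r q0); apply: (leq_trans (aq i)); apply: (leq_trans (pt i)).
  by rewrite /A -!mulnA mulnCA (mulnC k) leq_mul2l n2 orbT.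
have t1 : `|PM X (zvec [ffun i => a i * q]%N) (v n) - PM X (zvec p) (v n)|
    <= L * (t%:R ^+ d * d%:R * (q%:R / n%:R)).
  apply: (PM_lip_scaled hX n0 t0 hLn) => // i; rewrite ffunE //.
have t2 : `|PM X (zvec [ffun i => (a i * q)%N]) (v n) -
    PM X (zvec (Delta d q)) (v n) ^+ vol a| <= d%:R * A%:R ^+ d * e1.
  apply: le_trans (PM_box (t := t) (n := n) A0 aA _ _) _.
  - by rewrite (leq_trans (leq_div _ _)) // leq_pmull.
  - by move=> i; exact: leq_trans (aq i) (pt i).
  - by apply: ler_wpM2l => //; rewrite mulr_ge0 // exprn_ge0.
have t3 : `|PM X (zvec (Delta d q)) (v n) ^+ vol a - y ^+ vol a| <= A%:R ^+ d * e1.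
  apply: le_trans (expr_lip _ _ y01) _; first by rewrite PM_ge0 PM_le1.
  by apply: ler_pM => //; rewrite -natrX ler_nat; exact: vol_le_exp.
have yE : y ^+ vol a = expR (- (lam * ((vol a)%:R / k%:R ^+ d))).
  by rewrite /y -expRM_natl; congr expR; ring.
have t4 : `|y ^+ vol a - expR (- (lam * ((vol p)%:R / n%:R ^+ d)))|
    <= lam * ((2 * t)%:R ^+ d * d%:R * k%:R^-1).
  rewrite yE; apply: (le_trans (expRN_lip _ _)).
  - by rewrite mulr_ge0 // divr_ge0 // exprn_ge0.
  - by rewrite mulr_ge0 // divr_ge0 // exprn_ge0.
  rewrite -mulrBr normrM (ger0_norm lam0); apply: ler_wpM2l => //.
  rewrite !vol_ratio; apply: prod_lip_unif => [|i|i|i].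
  - by rewrite ler1n muln_gt0 t0.
  - rewrite divr_ge0 //= ler_pdivrMr // -natrM ler_nat; exact: aA.
  - rewrite divr_ge0 //= ler_pdivrMr // -natrM ler_nat.
    by apply: (leq_trans (pt i)); rewrite leq_mul2r leq_pmull ?orbT.
  have -> : (a i)%:R / k%:R - (p i)%:R / n%:R =
     ((a i * n)%:R - (p i * k)%:R) / (k%:R * n%:R) :> R.
    by rewrite !natrM; field; rewrite !gt_eqF.
  rewrite normrM [X in _ * X]ger0_norm; last by rewrite invr_ge0 mulr_ge0.
  rewrite invfM mulrA mulrAC -[leRHS]mul1r; apply: ler_wpM2r.
    by rewrite invr_ge0.
  rewrite ler_pdivrMr // mul1r ler_norml lerNl opprB !lerBlDr -!natrD !ler_nat.
  by apply: (grid_error qk qk') => //; apply: leq_trans An; rewrite leq_mul2r aA orbT.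
have -> : PM X (zvec p) (v n) - expR (- (lam * ((vol p)%:R / n%:R ^+ d))) =
  - (PM X (zvec [ffun i => a i * q]%N) (v n) - PM X (zvec p) (v n)) +
  (PM X (zvec [ffun i => (a i * q)%N]) (v n) -
    PM X (zvec (Delta d q)) (v n) ^+ vol a) +
  (PM X (zvec (Delta d q)) (v n) ^+ vol a - y ^+ vol a) +
  (y ^+ vol a - expR (- (lam * ((vol p)%:R / n%:R ^+ d)))) by ring.
apply: (@le_trans _ _ (L * (t%:R ^+ d * d%:R * (q%:R / n%:R)) +
  d%:R * A%:R ^+ d * e1 + A%:R ^+ d * e1 +
  lam * ((2 * t)%:R ^+ d * d%:R * k%:R^-1))).
  do 3 (apply: (le_trans (ler_normD _ _)); apply: lerD => //).
  by rewrite normrN.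
have qn : q%:R / n%:R <= k%:R^-1 :> R.
  by rewrite ler_pdivrMr // ler_pdivlMl // -natrM ler_nat mulnC.
have l1 : L * (t%:R ^+ d * d%:R * (q%:R / n%:R)) <= L * (t%:R ^+ d * d%:R * k%:R^-1).
  apply: ler_wpM2l; first exact: ltW.
  by apply: ler_wpM2l => //; rewrite mulr_ge0 // exprn_ge0.
have l2 : c1 / k%:R <= e / 2.
  by rewrite ler_pdivrMr // mulrC -ler_pdivrMr ?divr_gt0.
have l3 : c2 * e1 = e / 2 by rewrite /e1 mulrC divfK // gt_eqF.
move: l2 l3; rewrite /c1 /c2 mulrDl => l2 l3.
lra.
Unshelve. all: by end_near.
Qed.

End LevelAsymptotics.

(** * Real powers and logarithms *)

Section PowR.
Context (R : realType).

(** At a positive limit the power is a composition of [expR] and [ln]. The limit 0, where [ln]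
    fails, is treated directly with the threshold [e] to the power [1 / theta]. *)
Lemma powR_cvg (I : Type) (F : set_system I) {FF : Filter F} (f : I -> R)
    (a theta : R) : 0 < theta -> 0 <= a -> (forall i, 0 <= f i) ->
  f i @[i --> F] --> a -> f i `^ theta @[i --> F] --> a `^ theta.
Proof.
move=> t0 a0 f0 fa; have [a00|a_neq0] := eqVneq a 0.
  rewrite a00 powR0 ?gt_eqF //; apply/cvgrPdist_le => e e0.
  have e'0 : 0 < e `^ theta^-1 by rewrite powR_gt0.
  move/cvgrPdist_le : fa => /(_ _ e'0); rewrite a00; apply: filterS => i.
  rewrite !sub0r !normrN !ger0_norm ?powR_ge0 // => fe.
  have := ge0_ler_powR (ltW t0) (f0 i) (powR_ge0 _ _) fe.
  by rewrite -powRrM mulVf ?gt_eqF // powRr1 // ltW.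
have a1 : 0 < a by rewrite lt_neqAle eq_sym a_neq0.
have fpos : \forall i \near F, 0 < f i by apply: cvgr_gt fa _ a1.
rewrite /powR (negbTE a_neq0).
have /= H : expR (theta * ln (f i)) @[i --> F] --> expR (theta * ln a).
  apply: continuous_cvg; first exact: continuous_expR.
  apply: cvgM; first exact: cvg_cst.
  by apply: continuous_cvg => //; exact: continuous_ln.
apply: cvg_trans H; apply: near_eq_cvg; apply: filterS fpos => i fi.
by rewrite gt_eqF.
Qed.

(** With [N = n^d], this gives powers of [F] the shape of the limit in [PM_level_asymptotics]. *)
Lemma powR_exp (F theta N : R) (m : nat) : 0 < F -> N != 0 ->
  (F `^ theta) ^+ m = expR (- (theta * - (N * ln F) * (m%:R / N))).
Proof.
move=> F0 N0; rewrite /powR gt_eqF // -expRM_natl; congr expR.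
by field.
Qed.

Lemma one_subr_le_ln (x : R) : 0 < x -> 1 - x <= - ln x.
Proof.
move=> x0; have := @le_ln1Dx _ (x - 1).
have -> : 1 + (x - 1) = x by ring.
by move=> /(_ _); rewrite ltrBrDr addNr => /(_ x0); lra.
Qed.

End PowR.

(** * Uniform approximation in cones and its consequence along curves *)

Section UniformApproximation.
Context (R : realType) (d : nat) (disp : measure_display)
  (T : measurableType disp) (P : probability T R).
Implicit Types (X : {ffun 'I_d -> int} -> {RV P >-> R}) (p : {ffun 'I_d -> nat}).

(** Integer form of the sector: points of [[C^-1 j, C j]^d] satisfy it as soon as [C^2 <= K]. *)
Definition cone (K : nat) p := forall i j, (p i <= K * p j)%N.

Definition uniform_phantom X (G : R -> R) :=
  forall (K : nat) (e : R), 0 < e -> exists N : nat,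
    forall p, cone K p -> (forall i, N <= p i)%N ->
    forall x, `|PM X (zvec p) x - G x ^+ vol p| <= e.

Lemma uniform_phantom_along X G phi : (0 < d)%N ->
  uniform_phantom X G -> class_U_Delta R phi -> phantom_along X G phi.
Proof.
move=> d0 uG [[_ phioo _ _] [C C1 hC]]; apply/cvgrPdist_le => e e0.
have C0 : 0 < C by exact: lt_le_trans C1.
(* Two coordinates in [[C^-1 j, C j]] have a ratio of at most [C * C]. *)
have [K K0 CK] := nat_above (C * C).
have [N HN] := uG K e e0.
have hN : \forall n \near \oo, forall i, (N <= phi n i)%N.
  apply: filter_forall => i; move/(_ i) : phioo.
  by move=> /(_ _ (nbhs_infty_ge N)).
near=> n.
have phiN : forall i, (N <= phi n i)%N by near: n.
have [j j0 hj] : exists2 j : nat, (0 < j)%N &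
      forall i, C^-1 * j%:R <= (phi n i)%:R <= C * j%:R by near: n.
have cn : cone K (phi n).
  move=> i k; rewrite -(ler_nat R) natrM.
  have /andP[_ h1] := hj i; have /andP[h2 _] := hj k.
  apply: (le_trans h1).
  have h3 : j%:R <= C * (phi n k)%:R by rewrite mulrC -ler_pdivrMr // mulrC.
  apply: (@le_trans _ _ (C * C * (phi n k)%:R)); last exact: ler_wpM2r.
  by rewrite -mulrA ler_pM2l.
have ub : ubound [set `| PM X (zvec (phi n)) x - G x ^+ vol (phi n) | | x in [set: R]] e.
  by move=> _ [x _ <-]; exact: HN.
rewrite sub0r normrN ger0_norm.
  apply: ge_sup => //.
  by exists (`| PM X (zvec (phi n)) 0 - G 0 ^+ vol (phi n) |); exists 0.
apply: le_trans (normr_ge0 (PM X (zvec (phi n)) 0 - G 0 ^+ vol (phi n))) _.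
by apply: ub_le_sup; [exists e|exists 0].
Unshelve. all: by end_near.
Qed.

Lemma distribution_function_powR X (theta : R) : 0 < theta ->
  distribution_function (fun x => margF X x `^ theta).
Proof.
move=> t0; split.
- move=> x y xy; apply: ge0_ler_powR; rewrite ?nnegrE ?margF_ge0 ?(ltW t0) //.
  exact: margF_homo.
- move=> x; apply: powR_cvg => //; [exact: margF_ge0|by move=> y; exact: margF_ge0|].
  apply: fine_cvg; rewrite fineK; first exact: cdf_right_continuous.
  by rewrite fin_num_measure //; exact: measurable_itv.
- rewrite -(powR0 (x := theta)) ?gt_eqF //; apply: powR_cvg => //.
    by move=> y; exact: margF_ge0.
  by apply: fine_cvg; exact: cvg_cdfNy0.
- have -> : 1 = 1 `^ theta :> R by rewrite powR1.
  apply: powR_cvg => //.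
    by move=> y; exact: margF_ge0.
  by apply: fine_cvg; exact: cvg_cdfy1.
Qed.

(* [m] is the first index from [nlo] on with [x < v m], and both values at [x]
   lie between those at [v m.-1] and [v m]. *)
Lemma monotone_close (h1 h2 : R -> R) (v g : nat -> R) (e : R) (nlo nhi : nat) :
  {homo h1 : x y / x <= y} -> {homo h2 : x y / x <= y} ->
  (forall x, 0 <= h1 x <= 1) -> (forall x, 0 <= h2 x <= 1) -> (nlo <= nhi)%N ->
  (forall n, (nlo <= n)%N -> `|h1 (v n) - g n| <= e) ->
  (forall n, (nlo <= n)%N -> `|h2 (v n) - g n| <= e) ->
  (forall n, (nlo <= n)%N -> `|g n.+1 - g n| <= e) ->
  g nlo <= e -> 1 - e <= g nhi ->
  forall x, `|h1 x - h2 x| <= 3 * e.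
Proof.
move=> m1 m2 b1 b2 lohi a1 a2 ag glo ghi x.
have /andP[b10 b11] := b1 x; have /andP[b20 b21] := b2 x.
have [xhi|hix] := ltP x (v nhi); last first.
  have := m1 _ _ hix; have := m2 _ _ hix.
  have := a1 _ lohi; have := a2 _ lohi.
  by rewrite !ler_norml => /andP[? ?] /andP[? ?]; lra.
have ex : exists m, (nlo <= m)%N && (x < v m) by exists nhi; rewrite lohi.
case: (ex_minnP ex) => m /andP[lom xm] mmin.
have u1 := m1 _ _ (ltW xm); have u2 := m2 _ _ (ltW xm).
have := a1 _ lom; have := a2 _ lom.
rewrite !ler_norml => /andP[c1 c2] /andP[c3 c4].
have [em|nm] := eqVneq m nlo.
  by rewrite -em in glo; lra.
case: m => [|m] in lom xm mmin u1 u2 nm c1 c2 c3 c4 *.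
  by move: lom nm; rewrite leqn0 eq_sym => ->.
have lom' : (nlo <= m)%N by rewrite -ltnS ltn_neqAle eq_sym nm lom.
have vmx : v m <= x.
  by rewrite leNgt; apply/negP => xm'; have := mmin m; rewrite lom' xm' ltnn => /(_ isT).
have := m1 _ _ vmx; have := m2 _ _ vmx; have := a1 _ lom'; have := a2 _ lom'.
by have := ag _ lom'; rewrite !ler_norml => /andP[? ?] /andP[? ?] /andP[? ?]; lra.
Qed.

End UniformApproximation.

(** * From levels to uniform approximation *)

Section LevelsToUniform.
Context (R : realType) (d : nat) (disp : measure_display)
  (T : measurableType disp) (P : probability T R).
Variables (X : {ffun 'I_d -> int} -> {RV P >-> R}) (v : nat -> R) (gin theta : R).
Implicit Types p : {ffun 'I_d -> nat}.
Hypothesis gin0 : 0 < gin.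
Hypothesis gin1 : gin < 1.
Hypothesis hgin : margF X (v n) ^+ (n ^ d)%N @[n --> \oo] --> gin.

Lemma margF_level_gt0 : \forall n \near \oo, 0 < margF X (v n).
Proof.
near=> n.
have n0 : (0 < n)%N by near: n; exact: nbhs_infty_gt.
have h : 0 < margF X (v n) ^+ (n ^ d)%N by near: n; exact: cvgr_gt hgin _ gin0.
rewrite lt_neqAle margF_ge0 andbT eq_sym; apply/eqP => F0.
by move: h; rewrite F0 expr0n expn_eq0 gtn_eqF //= ltxx.
Unshelve. all: by end_near.
Qed.

Lemma ln_level_cvg :
  - (n%:R ^+ d * ln (margF X (v n))) @[n --> \oo] --> - ln gin.
Proof.
apply: cvgN.
have /= H : ln (margF X (v n) ^+ (n ^ d)%N) @[n --> \oo] --> ln gin.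
  by apply: continuous_cvg => //; exact: continuous_ln.
apply: cvg_trans H; apply: near_eq_cvg; apply: filterS margF_level_gt0 => n F0.
by rewrite lnXn // -(mulr_natl (ln _)) natrX.
Qed.

(** Follows from [1 - F <= - ln F], and supplies the constant [L] that makes the remainders of a
    cutting negligible. *)
Lemma tail_level_bound :
  \forall n \near \oo, n%:R ^+ d * (1 - margF X (v n)) <= - ln gin + 1.
Proof.
near=> n.
have F0 : 0 < margF X (v n) by near: n; exact: margF_level_gt0.
have : `|- (n%:R ^+ d * ln (margF X (v n))) - - ln gin| <= 1.
  by near: n; apply: cvg_near_dist => //; exact: ln_level_cvg.
rewrite ler_norml => /andP[_]; rewrite lerBlDl => /(le_trans _); apply.
rewrite -mulrN; apply: ler_wpM2l; first by rewrite exprn_ge0.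
exact: one_subr_le_ln.
Unshelve. all: by end_near.
Qed.

(** Both terms are exponentials whose exponents differ by [theta] times the error in [ln_level_cvg]
    times the normalised volume, which is at most [t^d]. *)
Lemma margF_level_asymptotics (t : nat) (e : R) : 0 < theta -> (0 < t)%N -> 0 < e ->
  \forall n \near \oo, forall p, (forall i, p i <= t * n)%N ->
    `|(margF X (v n) `^ theta) ^+ vol p -
      expR (- (theta * - ln gin * ((vol p)%:R / n%:R ^+ d)))| <= e.
Proof.
move=> th0 t0 e0.
have td0 : 0 < theta * t%:R ^+ d by rewrite mulr_gt0 // exprn_gt0 // ltr0n.
have lg0 : 0 <= - ln gin by rewrite oppr_ge0 -ln1 ler_ln ?posrE // ltW.
near=> n => p pt.
have n0 : (0 < n)%N by near: n; exact: nbhs_infty_gt.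
have n0' : 0 < n%:R :> R by rewrite ltr0n.
have nd0 : 0 < n%:R ^+ d :> R by rewrite exprn_gt0.
have F0 : 0 < margF X (v n) by near: n; exact: margF_level_gt0.
have F1 := margF_le1 X (v n).
have hs : `|- (n%:R ^+ d * ln (margF X (v n))) - - ln gin| <= e / (theta * t%:R ^+ d).
  by near: n; apply: cvg_near_dist; [exact: ln_level_cvg|exact: divr_gt0].
rewrite (powR_exp _ _ F0 (lt0r_neq0 nd0)).
have s0 : 0 <= - (n%:R ^+ d * ln (margF X (v n))).
  by rewrite -mulrN mulr_ge0 ?(ltW nd0) // oppr_ge0 -ln1 ler_ln ?posrE.
have r0 : 0 <= (vol p)%:R / n%:R ^+ d :> R by rewrite divr_ge0 // ltW.
have rt : (vol p)%:R / n%:R ^+ d <= t%:R ^+ d :> R.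
  by rewrite ler_pdivrMr // -exprMn -natrM -natrX ler_nat; exact: vol_le_exp.
apply: (le_trans (expRN_lip _ _)); first by rewrite !mulr_ge0 // ltW.
  by rewrite !mulr_ge0 // ltW.
rewrite -mulrBl -mulrBr normrM (ger0_norm r0) normrM (gtr0_norm th0).
apply: (@le_trans _ _ (theta * (e / (theta * t%:R ^+ d)) * t%:R ^+ d)).
  apply: ler_pM => //; first by rewrite mulr_ge0 // ltW.
  by rewrite ler_pM2l.
have t0' : t%:R != 0 :> R by rewrite pnatr_eq0 -lt0n.
by rewrite le_eqVlt; apply/orP; left; apply/eqP; field; rewrite expf_neq0 //= gt_eqF.
Unshelve. all: by end_near.
Qed.

Hypothesis hX : stationary X.
Variable gor : R.
Hypothesis gor0 : 0 < gor.
Hypothesis gor1 : gor < 1.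
Hypothesis hgor : PM X (zvec (Delta d n)) (v n) @[n --> \oo] --> gor.
Hypothesis hbeta : forall t : R, 0 < t -> beta X v t n @[n --> \oo] --> (0 : R).
Hypothesis thetaE : theta = ln gor / ln gin.

(** Let [j] be one side of [p]. As [n] runs from [nlo], about [j / B], to [nhi = B * j], the common
    asymptotic value [g n] goes from at most [e] to at least [1 - e] in steps of at most [e], so
    [monotone_close] covers all real [x]. *)
Lemma levels_uniform_phantom : (0 < d)%N ->
  uniform_phantom X (fun x => margF X x `^ theta).
Proof.
move=> d0 K0 e0 e0_gt0.
pose K := K0.+1; pose e := e0 / 3.
have e_gt0 : 0 < e by rewrite divr_gt0.
have lgin : ln gin < 0 by rewrite ln_lt0 // gin0.
have lgor : ln gor < 0 by rewrite ln_lt0 // gor0.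
pose lam := - ln gor.
have lam0 : 0 < lam by rewrite oppr_gt0.
have th0 : 0 < theta by rewrite thetaE -mulrNN -invrN divr_gt0 // oppr_gt0.
have lamE : theta * - ln gin = lam.
  by rewrite thetaE /lam mulrN divfK // lt_eqF.
(* Chosen so that [expR (- (lam * b)) <= e] and [1 - e <= expR (- (lam / b))]. *)
have [b b0 hb] := nat_above (Num.max ((lam * e)^-1) (lam / e)).
move: hb; rewrite ge_max => /andP[hb1 hb2].
have b0' : 0 < b%:R :> R by rewrite ltr0n.
(* The factor [K] absorbs the aspect ratio of [p], so that all ratios [p i / nlo] are at least [b]
   and all [p i / nhi] at most [1 / b]. *)
pose B := (K * b)%N; have B0 : (0 < B)%N by rewrite muln_gt0.
(* Ensures [p i <= t * n] for every [n] from [nlo] on, since [j <= 2 * (nlo * B)]. *)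
pose t := (2 * K * B)%N; have t0 : (0 < t)%N by rewrite muln_gt0 B0.
have L0 : 0 < - ln gin + 1 by rewrite ltr_wpDl // oppr_ge0 ltW.
have [N1 _ HN1] := PM_level_asymptotics hX gor0 (ltW gor1) hgor L0
  tail_level_bound hbeta t0 e_gt0.
have [N2 _ HN2] := margF_level_asymptotics th0 t0 e_gt0.
(* From [N3] on, consecutive values of [g] differ by at most [e]. *)
have [N3 N30 HN3] := nat_above (lam * (t%:R ^+ d * d%:R * t%:R) / e).
pose N := maxn N3 (maxn N1 N2).
exists (B * N)%N => p cp pN x.
have -> : e0 = 3 * e by rewrite /e; field.
pose j := p (Ordinal d0).
have jB : (B * N <= j)%N by exact: pN.
pose nlo := (j %/ B)%N; pose nhi := (B * j)%N.
have loN : (N <= nlo)%N by rewrite leq_divRL // mulnC.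
have N0 : (0 < N)%N by rewrite leq_max N30.
have lo0 : (0 < nlo)%N by exact: leq_trans loN.
have pj i : (p i <= K * j)%N.
  by apply: leq_trans (cp i (Ordinal d0)) _; rewrite leq_mul2r leqnSn orbT.
have jp i : (j <= K * p i)%N.
  by apply: leq_trans (cp (Ordinal d0) i) _; rewrite leq_mul2r leqnSn orbT.
have jlo : (j < nlo * B + B)%N by rewrite -mulSnr ltn_ceil.
have loj : (nlo * B <= j)%N by exact: leq_divM.
have pt n i : (nlo <= n)%N -> (p i <= t * n)%N.
  move=> lon; apply: leq_trans (pj i) _.
  have -> : (t * n = K * (2 * (n * B)))%N by rewrite /t (mulnC n) -!mulnA mulnCA.
  rewrite leq_mul2l; apply/orP; right.
  apply: leq_trans (grid_le_double lo0 jlo) _.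
  by rewrite leq_mul2l leq_mul2r lon !orbT.
have r0 n : 0 <= (vol p)%:R / n%:R ^+ d :> R by rewrite divr_ge0 // exprn_ge0.
pose g n := expR (- (lam * ((vol p)%:R / n%:R ^+ d))).
apply: (@monotone_close _ (fun x => PM X (zvec p) x)
  (fun x => (margF X x `^ theta) ^+ vol p) v g e nlo nhi).
- by move=> y z; exact: PM_homo.
- move=> y z yz; apply: lerXn2r; rewrite ?nnegrE ?powR_ge0 //.
  apply: ge0_ler_powR; rewrite ?nnegrE ?margF_ge0 ?(ltW th0) //.
  exact: margF_homo.
- by move=> y; rewrite PM_ge0 PM_le1.
- move=> y; rewrite exprn_ge0 ?powR_ge0 //= exprn_ile1 ?powR_ge0 //.
  have -> : 1 = 1 `^ theta :> R by rewrite powR1.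
  apply: ge0_ler_powR; rewrite ?nnegrE ?margF_ge0 ?(ltW th0) //.
  exact: margF_le1.
- by apply: leq_trans (leq_div _ _) _; rewrite leq_pmull.
- move=> n lon; apply: HN1 => [/=|i]; last exact: pt.
  by apply: leq_trans lon; apply: leq_trans loN; rewrite !leq_max leqnn !orbT.
- move=> n lon; rewrite /g -lamE; apply: HN2 => [/=|i]; last exact: pt.
  by apply: leq_trans lon; apply: leq_trans loN; rewrite !leq_max leqnn !orbT.
- move=> n lon; have n0 : (0 < n)%N by exact: leq_trans lon.
  have n0' : 0 < n%:R :> R by rewrite ltr0n.
  have n1' : 0 < n.+1%:R :> R by rewrite ltr0n.
  rewrite /g; apply: (le_trans (expRN_lip _ _)); rewrite ?mulr_ge0 ?(ltW lam0) //.
  rewrite -mulrBr normrM (gtr0_norm lam0) !vol_ratio.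
  have pr i m : (0 < m)%N -> (p i <= t * m)%N -> 0 <= (p i)%:R / m%:R <= (t%:R : R).
    by move=> m0 ptm; rewrite divr_ge0 //= ler_pdivrMr ?ltr0n // -natrM ler_nat.
  have H : `|\prod_i ((p i)%:R / n.+1%:R) - \prod_i ((p i)%:R / n%:R)| <=
    t%:R ^+ d * d%:R * (t%:R / n%:R) :> R.
    apply: prod_lip_unif => [|i|i|i].
    + by rewrite ler1n.
    + by apply: pr => //; apply: pt; exact: leqW.
    + by apply: pr => //; exact: pt.
    + have -> : (p i)%:R / n.+1%:R - (p i)%:R / n%:R =
          - ((p i)%:R / (n.+1%:R * n%:R)) :> R.
        by rewrite -natr1; field; rewrite natr1 !gt_eqF.
      rewrite normrN ger0_norm ?divr_ge0 ?mulr_ge0 // invfM mulrA.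
      apply: ler_wpM2r; first by rewrite invr_ge0.
      rewrite ler_pdivrMr // -natrM ler_nat; apply: leq_trans (pt n i lon) _.
      by rewrite leq_mul2l leqnSn orbT.
  apply: (le_trans (ler_wpM2l (ltW lam0) H)).
  rewrite !mulrA ler_pdivrMr // (mulrC e) -ler_pdivrMr //.
  have N3n : N3%:R <= n%:R :> R.
    by rewrite ler_nat; apply: leq_trans lon; apply: leq_trans loN; rewrite leq_max leqnn.
  by apply: le_trans N3n; apply: le_trans HN3; rewrite !mulrA.
- have lo0' : 0 < nlo%:R :> R by rewrite ltr0n.
  have Hr : b%:R <= (vol p)%:R / nlo%:R ^+ d :> R.
    rewrite vol_ratio; apply: (@le_trans _ _ (b%:R ^+ d)).
      by rewrite -[X in X <= _]expr1; apply: ler_weXn2l => //; rewrite ler1n.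
    rewrite -[d in b%:R ^+ d]card_ord -prodr_const; apply: ler_prod => i _.
    rewrite ler0n /= ler_pdivlMr // -natrM ler_nat.
    have := jp i; move: loj; rewrite /B => H1 H2.
    rewrite -(leq_pmul2l (ltn0Sn K0)); apply: leq_trans H2.
    by apply: leq_trans H1; rewrite -/K mulnA mulnC.
  have H1 : (lam * e)^-1 * lam <= lam * ((vol p)%:R / nlo%:R ^+ d).
    by rewrite mulrC ler_pM2l //; exact: le_trans Hr.
  have e1 : (lam * e)^-1 * lam = e^-1 by field; rewrite !gt_eqF.
  rewrite e1 in H1; rewrite /g expRN invf_ple ?posrE ?expR_gt0 //.
  apply: (le_trans H1); apply: le_trans (expR_ge1Dx _).
  by rewrite lerDr.
- have j0 : (0 < j)%N by apply: leq_trans jB; rewrite muln_gt0 B0.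
  have hi0 : 0 < nhi%:R :> R by rewrite ltr0n muln_gt0 B0.
  have Hr : (vol p)%:R / nhi%:R ^+ d <= b%:R^-1 :> R.
    rewrite vol_ratio; apply: (@le_trans _ _ (b%:R^-1 ^+ d)).
      rewrite -[d in _ ^+ d]card_ord -prodr_const; apply: ler_prod => i _.
      rewrite divr_ge0 //= ler_pdivrMr // ler_pdivlMl // -natrM ler_nat.
      by rewrite /nhi /B -mulnA mulnCA leq_mul2l pj orbT.
    rewrite -[X in _ <= X]expr1; apply: ler_wiXn2l => //.
    by rewrite invf_le1 // ler1n.
  rewrite /g; apply: le_trans (expR_ge1Dx _); rewrite lerD2l lerN2.
  apply: (@le_trans _ _ (lam / b%:R)); first by rewrite ler_pM2l.
  by rewrite ler_pdivrMr // mulrC -ler_pdivrMr.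
Qed.

End LevelsToUniform.

(** * A curve in a cone through infinitely many prescribed points *)

Section Curve.
Variables (d K : nat).
Implicit Types c t : {ffun 'I_d -> nat}.
Hypothesis K2 : (1 < K)%N.

(** Progress measure: every step of the curve raises it by exactly one. *)
Definition weight c : nat := \sum_i c i.

Definition lowest c t : option 'I_d :=
  [pick i | (c i < t i)%N && [forall j, (c j < t j)%N ==> (c i <= c j)%N]].

Definition climb c t : {ffun 'I_d -> nat} :=
  if lowest c t is Some i then upd c i (c i).+1 else c.

Lemma weight_ge c i : (c i <= weight c)%N.
Proof. by rewrite /weight (bigD1 i) //= leq_addr. Qed.

Lemma weight_le c t : (forall i, c i <= t i)%N -> (weight c <= weight t)%N.
Proof. by move=> ct; apply: leq_sum. Qed.

Lemma weight_upd c i : weight (upd c i (c i).+1) = (weight c).+1.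
Proof.
rewrite /weight (bigD1 i) //= [in RHS](bigD1 i) //= ffunE eqxx addSn.
by congr (_ + _).+1; apply: eq_bigr => j /negbTE ji; rewrite ffunE ji.
Qed.

(** Below [t] and away from it some coordinate is unfinished, and a least unfinished one is eligible
    for [lowest]; the default branch of [climb] does not occur. *)
Lemma climbP c t : (forall i, c i <= t i)%N -> c != t ->
  exists i, [/\ (c i < t i)%N, forall j, (c j < t j)%N -> (c i <= c j)%N
              & climb c t = upd c i (c i).+1].
Proof.
move=> ct neq; rewrite /climb /lowest; case: pickP => [i|H].
  move=> /andP[cti /forallP H]; exists i; split => // j ctj.
  by have := H j; rewrite ctj.
have [i cti] : exists i, (c i < t i)%N.
  apply: contrapT => H'; move/eqP : neq; apply; apply/ffunP => i.
  apply/eqP; rewrite eqn_leq ct leqNgt; apply/negP => cti; apply: H'.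
  by exists i.
case: (@arg_minnP _ i (fun i => c i < t i)%N c cti) => j ctj jmin.
have := H j; rewrite ctj /= => /negP[]; apply/forallP => k; apply/implyP.
exact: jmin.
Qed.

(* Since [c i] is minimal among the unfinished coordinates, it is comparable with
   these, and the finished ones equal those of [t], which lies in the cone. *)
Lemma upd_succ_cone c t i : cone K c -> cone K t -> (forall j, 0 < c j)%N ->
  (forall j, c j <= t j)%N -> (c i < t i)%N ->
  (forall j, (c j < t j)%N -> (c i <= c j)%N) -> cone K (upd c i (c i).+1).
Proof.
move=> cc ct c0 le_ct cti cmin a b; rewrite !ffunE.
case: eqVneq => [_|ai]; case: eqVneq => [_|bi].
- by rewrite leq_pmull // ltnW.
- have [ctb|tcb] := ltnP (c b) (t b).
    apply: (@leq_ltn_trans (c b)); first exact: cmin.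
    by rewrite -[X in (X < _)%N]mul1n ltn_pmul2r // c0.
  have -> : c b = t b by apply/eqP; rewrite eqn_leq le_ct.
  exact: leq_trans cti (ct i b).
- by apply: leq_trans (cc a i) _; rewrite leq_mul2l leqnSn orbT.
- exact: cc.
Qed.

Variable target : nat -> {ffun 'I_d -> nat}.
Hypothesis target_cone : forall N, cone K (target N).
Hypothesis target_ge : forall N i, (N <= target N i)%N.
Hypothesis d0 : (0 < d)%N.

(* The state is the current point of the curve and the target it climbs to. *)
Definition curve_step (s : {ffun 'I_d -> nat} * {ffun 'I_d -> nat}) :=
  let t := if s.1 == s.2 then target (weight s.1).+1 else s.2 in
  (climb s.1 t, t).

Definition curve_state n := iter n curve_step (target 1, target 1).

Definition curve n := (curve_state n).1.

(** A target that has been reached is replaced by one of index [(weight c).+1], all of whose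
    coordinates strictly exceed those of [c]. Hence there is always something left to climb. *)
Lemma curve_next n : (forall i, curve n i <= (curve_state n).2 i)%N ->
  (forall i, curve n i <= (curve_state n.+1).2 i)%N /\ curve n != (curve_state n.+1).2.
Proof.
rewrite /curve /= /curve_step; case: (curve_state n) => c t /= ct.
case: eqVneq => // _.
have lt i : (c i < target (weight c).+1 i)%N.
  by apply: leq_trans (target_ge _ _); rewrite ltnS weight_ge.
split=> [i|]; first exact: ltnW.
by apply/eqP => /ffunP/(_ (Ordinal d0)) E; have := lt (Ordinal d0); rewrite -E ltnn.
Qed.

(** Recording that the current goal is some [target N] provides the cone condition that
    [upd_succ_cone] requires of it. *)
Lemma curve_inv n :
  [/\ forall i, (curve n i <= (curve_state n).2 i)%N, forall i, (0 < curve n i)%N,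
      cone K (curve n) & exists N, (curve_state n).2 = target N].
Proof.
elim: n => [|n [le_ct c0 cc [N tN]]].
  split; last by exists 1%N.
  - by move=> i; exact: leqnn.
  - by move=> i; exact: (target_ge 1 i).
  - exact: (target_cone 1).
have [le_ct' neq] := curve_next le_ct.
have [i [cti cmin cE]] := climbP le_ct' neq.
have E : curve n.+1 = upd (curve n) i (curve n i).+1 by rewrite -cE.
have [N' tN'] : exists N', (curve_state n.+1).2 = target N'.
  by rewrite /= /curve_step /=; case: ifP => _; [eexists|exists N].
split; last by exists N'.
- by move=> j; rewrite E ffunE; case: eqVneq => [->|_].
- by move=> j; rewrite E ffunE; case: ifP.
- by rewrite E; apply: upd_succ_cone le_ct' cti cmin => //; rewrite tN'.
Qed.

Lemma curve_succ n : exists i, curve n.+1 = upd (curve n) i (curve n i).+1.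
Proof.
have [le_ct _ _ _] := curve_inv n.
have [le_ct' neq] := curve_next le_ct.
by have [i [_ _ cE]] := climbP le_ct' neq; exists i; rewrite -cE.
Qed.

Lemma curve_cone n : cone K (curve n).
Proof. by case: (curve_inv n). Qed.

Lemma weight_curve n : weight (curve n.+1) = (weight (curve n)).+1.
Proof. by have [i ->] := curve_succ n; rewrite weight_upd. Qed.

(** Induction on the weight still missing to the current target: until it is reached the target
    stays fixed and each step reduces the deficit by one. *)
Lemma curve_hits n : exists m N, (n <= m)%N /\ curve m = target N.
Proof.
have [k] : exists k, (weight (curve_state n).2 <= weight (curve n) + k)%N.
  by exists (weight (curve_state n).2); rewrite leq_addl.
elim: k n => [|k IH] n hk.
all: have [le_ct c0 cc [N tN]] := curve_inv n.
all: have [E|neq] := eqVneq (curve n) (curve_state n).2.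
all: try by exists n, N; rewrite leqnn -tN.
all: have tE : (curve_state n.+1).2 = (curve_state n).2
  by rewrite /= /curve_step /= (negbTE neq).
- have [le_ct' _ _ _] := curve_inv n.+1.
  have := weight_le le_ct'; rewrite tE weight_curve => H.
  by move: hk; rewrite addn0 leqNgt H.
- have [|m [M [nm mM]]] := IH n.+1.
    by rewrite tE weight_curve addSnnS.
  by exists m, M; rewrite ltnW.
Qed.

(** The weight is at least [n], and in the cone it is at most [d * K] times any single
    coordinate. *)
Lemma curve_ge N : \forall n \near \oo, forall i, (N <= curve n i)%N.
Proof.
have K0 : (0 < K)%N by exact: ltnW.
have H n i : (n <= d * (K * curve n i))%N.
  apply: (@leq_trans (weight (curve n))).
    by elim: n => // n IH; rewrite weight_curve ltnS.
  rewrite /weight -[d in (d * _)%N]card_ord -sum_nat_const.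
  by apply: leq_sum => j _; exact: curve_cone.
exists (d * (K * N))%N => //= n dn i.
have := leq_trans dn (H n i).
by rewrite leq_pmul2l // leq_pmul2l.
Qed.

Lemma curve_class (R : realType) : class_U_Delta R curve.
Proof.
have K0 : (0 < K)%N by exact: ltnW.
split; last first.
  exists K%:R; first by rewrite ler1n.
  (* The first coordinate serves as [j]; the cone puts every coordinate between [j / K] and
     [K * j]. *)
  near=> n; exists (curve n (Ordinal d0)); first by case: (curve_inv n).
  move=> i; rewrite ler_pdivrMl ?ltr0n // -!natrM !ler_nat.
  by rewrite !curve_cone.
split.
- by move=> n _; case: (curve_inv n).
- move=> i; apply/cvgnyPge => A; apply: filterS (curve_ge A) => n; exact.
- move=> n _; have [i E] := curve_succ n; rewrite E; split.
    by move=> j; rewrite ffunE; case: eqVneq => [->|_] //; exact: leqnSn.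
  by move=> /ffunP/(_ i); rewrite ffunE eqxx => /n_Sn.
- apply/cvgrPdist_le => e e0; have [N N0 hN] := nat_above e^-1.
  apply: filterS (curve_ge N) => n hn.
  have [i E] := curve_succ n; have [_ c0 _ _] := curve_inv n.
  have ci0 : (0 < curve n i)%N by [].
  have vE : ((vol (curve n.+1))%:R : R) = (curve n i).+1%:R *
      (vol (curve n))%:R / (curve n i)%:R.
    rewrite E /vol (bigD1 i) //= [in RHS](bigD1 i) //= ffunE eqxx !natrM.
    rewrite (eq_bigr (curve n)); last by move=> j /negbTE ji; rewrite ffunE ji.
    by field; rewrite pnatr_eq0 -lt0n.
  have v0 : (0 < vol (curve n))%N by apply: prodn_gt0.
  (* Raising a side from [c] to [c + 1] multiplies the volume by [(c + 1) / c], so the ratio misses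
     1 by [1 / (c + 1)]. *)
  have -> : 1 - (vol (curve n))%:R / (vol (curve n.+1))%:R =
      (curve n i).+1%:R^-1 :> R.
    rewrite vE -natr1; field.
    by rewrite natr1 !pnatr_eq0 -!lt0n ci0 v0.
  rewrite ger0_norm ?invr_ge0 // invf_ple ?posrE ?ltr0n //.
  by apply: (le_trans hN); rewrite ler_nat leqW.
Unshelve. all: by end_near.
Qed.

End Curve.

(** * From curves to uniform approximation *)

Section PhantomToUniform.
Context (R : realType) (d : nat) (disp : measure_display)
  (T : measurableType disp) (P : probability T R).
Variables (X : {ffun 'I_d -> int} -> {RV P >-> R}) (G : R -> R).
Hypothesis G01 : forall x, 0 <= G x <= 1.

Lemma phantom_uniform : (0 < d)%N ->
  (forall phi, class_U_Delta R phi -> phantom_along X G phi) ->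
  uniform_phantom X G.
Proof.
move=> d0 hphi K e e0; apply: contrapT => nN.
pose bad (p : {ffun 'I_d -> nat}) := exists x, e < `|PM X (zvec p) x - G x ^+ vol p|.
(* Failure of uniformity yields a bad point beyond every [N]. The cone is enlarged to [K.+2] to meet
   the condition [1 < K] of the curve construction. *)
have /choice[target ht] : forall N, exists p,
    [/\ cone K.+2 p, forall i, (N <= p i)%N & bad p].
  move=> N; apply: contrapT => H; apply: nN; exists N => p cp pN x.
  rewrite leNgt; apply/negP => ex; apply: H; exists p; split => //; last by exists x.
  move=> i j; apply: leq_trans (cp i j) _.
  by rewrite leq_mul2r (leq_trans (leqnSn _)) ?orbT.
have tc N : cone K.+2 (target N) by case: (ht N).
have tg N i : (N <= target N i)%N by case: (ht N).
have K2 : (1 < K.+2)%N by [].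
have := hphi _ (curve_class K2 tc tg d0 R).
move=> /cvgrPdist_lt/(_ e e0) [n0 _ hn0].
(* The curve meets a bad point after the index from which its supremum stays below [e]. *)
have [m [N [nm mN]]] := curve_hits K2 tc tg d0 n0.
have [_ _ [x hx]] := ht N.
have /= := hn0 m nm; rewrite sub0r normrN mN => hs.
suff : e < e by rewrite ltxx.
apply: (lt_trans hx); apply: le_lt_trans hs; apply: le_trans (ler_norm _).
apply: ub_le_sup; last by exists x.
exists 1 => _ [y _ <-].
have /andP[G0 G1] := G01 y.
have := PM_ge0 X (target N) y; have := PM_le1 X (target N) y.
have := exprn_ge0 (vol (target N)) G0.
have : G y ^+ vol (target N) <= 1 by exact: exprn_ile1.
by rewrite ler_norml; lra.
Qed.

End PhantomToUniform.

(** * From uniform approximation to the vanishing of the mixing coefficient *)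

Section UniformToBeta.
Context (R : realType) (d : nat) (disp : measure_display)
  (T : measurableType disp) (P : probability T R).
Variables (X : {ffun 'I_d -> int} -> {RV P >-> R}) (v : nat -> R) (gin theta : R).
Implicit Types p : {ffun 'I_d -> nat}.
Hypothesis hX : stationary X.
Hypothesis d0 : (0 < d)%N.
Hypothesis gin0 : 0 < gin.
Hypothesis gin1 : gin < 1.
Hypothesis hgin : margF X (v n) ^+ (n ^ d)%N @[n --> \oo] --> gin.
Hypothesis theta0 : 0 < theta.
Hypothesis theta1 : theta <= 1.
Hypothesis hunif : uniform_phantom X (fun x => margF X x `^ theta).

Lemma margF_powR_itv x : 0 <= margF X x `^ theta <= 1.
Proof.
rewrite powR_ge0 /=.
have -> : 1 = 1 `^ theta :> R by rewrite powR1.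
apply: ge0_ler_powR; rewrite ?nnegrE ?margF_ge0 ?(ltW theta0) //.
exact: margF_le1.
Qed.

(* A box with one side below [n / k] has volume of order [n ^ d / k], which makes
   both quantities close to 1; all other boxes lie in a cone. *)
Lemma level_uniform (t : nat) (e : R) : (0 < t)%N -> 0 < e ->
  \forall n \near \oo, forall p, (forall i, p i <= t * n)%N ->
    `|PM X (zvec p) (v n) - (margF X (v n) `^ theta) ^+ vol p| <= e.
Proof.
move=> t0 e0; pose L := - ln gin + 1.
have L0 : 0 < L by rewrite ltr_wpDl // oppr_ge0 ltW // ln_lt0 // gin0.
have [k k0 hk] := nat_above (t%:R ^+ d * L / e).
have [N HN] := hunif (t * k) e0.
near=> n => p pt.
have n0 : (0 < n)%N by near: n; exact: nbhs_infty_gt.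
have n0' : 0 < n%:R :> R by rewrite ltr0n.
have nd0 : 0 < n%:R ^+ d :> R by rewrite exprn_gt0.
have k0' : 0 < k%:R :> R by rewrite ltr0n.
have Nn : (k * N <= n)%N by near: n; exact: nbhs_infty_ge.
have hF : n%:R ^+ d * (1 - margF X (v n)) <= L.
  by near: n; exact: tail_level_bound gin0 hgin.
have F0 : 0 < margF X (v n) by near: n; exact: margF_level_gt0 gin0 hgin.
have hs : - (n%:R ^+ d * ln (margF X (v n))) <= L.
  have : `|- (n%:R ^+ d * ln (margF X (v n))) - - ln gin| <= 1.
    by near: n; apply: cvg_near_dist => //; exact: ln_level_cvg gin0 hgin.
  by rewrite ler_norml /L => /andP[_]; rewrite lerBlDl.
have [[i pi]|allp] := pselect (exists i, (k * p i <= n)%N); last first.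
  have np i : (n <= k * p i)%N.
    by rewrite leqNgt; apply/negP => H; apply: allp; exists i; exact: ltnW.
  apply: HN => [i j|i].
    by apply: leq_trans (pt i) _; rewrite -mulnA leq_mul2l np orbT.
  by rewrite -(leq_pmul2l k0); exact: leq_trans Nn (np i).
have r0 : 0 <= (vol p)%:R / n%:R ^+ d :> R by rewrite divr_ge0 // ltW.
have rle : (vol p)%:R / n%:R ^+ d <= t%:R ^+ d / k%:R :> R.
  rewrite vol_ratio.
  have xb j : 0 <= ((p j)%:R / n%:R : R) <= t%:R.
    by rewrite divr_ge0 //= ler_pdivrMr // -natrM ler_nat.
  have t1 : 1 <= t%:R :> R by rewrite ler1n.
  (* Comparing with the product whose factor [i] is replaced by 0 bounds the normalised volume by
     [t^d * (p i / n)]. *)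
  pose y j : R := if j == i then 0 else (p j)%:R / n%:R.
  have yb j : 0 <= y j <= t%:R.
    by rewrite /y; case: eqP => _; [rewrite lexx ler0n | exact: xb].
  have := prod_lip t1 xb yb.
  have -> : \prod_j y j = 0 by rewrite (bigD1 i) //= /y eqxx mul0r.
  have -> : \sum_j `|(p j)%:R / n%:R - y j| = (p i)%:R / n%:R.
    rewrite (bigD1 i) //= big1 ?addr0 => [|j /negbTE ji].
      by rewrite /y eqxx subr0 ger0_norm ?divr_ge0.
    by rewrite /y ji subrr normr0.
  rewrite subr0 card_ord => /(le_trans (ler_norm _))/le_trans; apply.
  apply: ler_wpM2l; first by rewrite exprn_ge0.
  by rewrite ler_pdivrMr // ler_pdivlMl // -natrM ler_nat.
have small : (vol p)%:R / n%:R ^+ d * L <= e.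
  apply: (@le_trans _ _ (t%:R ^+ d / k%:R * L)); first by rewrite ler_pM2r.
  by rewrite mulrAC ler_pdivrMr // (mulrC e) -ler_pdivrMr.
have h1 : 1 - PM X (zvec p) (v n) <= e.
  apply: (le_trans (PM_ge_union hX _ _ d0)); apply: le_trans small.
  have -> : (vol p)%:R * (1 - margF X (v n)) =
    (vol p)%:R / n%:R ^+ d * (n%:R ^+ d * (1 - margF X (v n))).
    by field; rewrite gt_eqF.
  exact: ler_wpM2l.
have h2 : 1 - (margF X (v n) `^ theta) ^+ vol p <= e.
  rewrite (powR_exp _ _ F0 (lt0r_neq0 nd0)).
  set s := - (n%:R ^+ d * ln (margF X (v n))) in hs *.
  have s0 : 0 <= s.
    rewrite /s -mulrN mulr_ge0 ?(ltW nd0) // oppr_ge0 -ln1 ler_ln ?posrE //.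
    exact: margF_le1.
  have := expR_ge1Dx (- (theta * s * ((vol p)%:R / n%:R ^+ d))) => E.
  apply: (@le_trans _ _ (theta * s * ((vol p)%:R / n%:R ^+ d))); first lra.
  apply: le_trans small; rewrite [leRHS]mulrC; apply: ler_wpM2r => //.
  by apply: le_trans hs; rewrite ler_piMl.
have /andP[g0 g1] := margF_powR_itv (v n).
have g1' : (margF X (v n) `^ theta) ^+ vol p <= 1 by exact: exprn_ile1.
have q1 := PM_le1 X p (v n).
by rewrite ler_norml; apply/andP; split; lra.
Unshelve. all: by end_near.
Qed.

Lemma level_cube_cvg : PM X (zvec (Delta d n)) (v n) @[n --> \oo] --> gin `^ theta.
Proof.
have gc : (margF X (v n) `^ theta) ^+ (n ^ d)%N @[n --> \oo] --> gin `^ theta.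
  have /= H : (margF X (v n) ^+ (n ^ d)%N) `^ theta @[n --> \oo] --> gin `^ theta.
    by apply: powR_cvg => //; [exact: ltW|move=> n; rewrite exprn_ge0 // margF_ge0].
  apply: cvg_trans H; apply: near_eq_cvg; apply: nearW => n.
  rewrite -(powR_mulrn _ (margF_ge0 X (v n))) -(powR_mulrn _ (powR_ge0 _ _)).
  exact: powRAC.
apply/cvgrPdist_le => e e0; have e2 : 0 < e / 2 by rewrite divr_gt0.
near=> n.
have h1 : `|(margF X (v n) `^ theta) ^+ (n ^ d)%N - gin `^ theta| <= e / 2.
  by near: n; exact: cvg_near_dist.
have h2 : `|PM X (zvec (Delta d n)) (v n) - (margF X (v n) `^ theta) ^+ vol (Delta d n)|
    <= e / 2.
  have H : forall p, (forall i, p i <= 1 * n)%N ->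
    `|PM X (zvec p) (v n) - (margF X (v n) `^ theta) ^+ vol p| <= e / 2.
    by near: n; exact: level_uniform.
  by apply: H => i; rewrite ffunE mul1n.
rewrite vol_Delta in h2; rewrite distrC.
have -> : PM X (zvec (Delta d n)) (v n) - gin `^ theta =
  (PM X (zvec (Delta d n)) (v n) - (margF X (v n) `^ theta) ^+ (n ^ d)%N) +
  ((margF X (v n) `^ theta) ^+ (n ^ d)%N - gin `^ theta) by ring.
by apply: (le_trans (ler_normD _ _)); have := lerD h2 h1; lra.
Unshelve. all: by end_near.
Qed.

(** Distributivity: expanding the product of the sums [p1 l + p2 l] gives one term per choice of a
    summand in each coordinate. *)
Lemma vol_split (p1 p2 : {ffun 'I_d -> nat}) :
  (\sum_(s : {ffun 'I_d -> bool}) vol [ffun l => if s l then p2 l else p1 l])%N =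
  vol [ffun l => p1 l + p2 l]%N.
Proof.
rewrite /vol (eq_bigr (fun s : {ffun 'I_d -> bool} =>
    \prod_(l < d) (fun l b => if b then p2 l else p1 l) l (s l))%N); last first.
  by move=> s _; apply: eq_bigr => l _; rewrite ffunE.
rewrite -(bigA_distr_bigA (fun l (b : bool) => if b then p2 l else p1 l)).
by apply: eq_bigr => l _; rewrite ffunE big_bool addnC.
Qed.

(** Each probability is replaced by a power of [g], with exponent the volume of its box; by
    [vol_split] the powers then cancel exactly. *)
Lemma level_beta_cvg (t : R) : 0 < t -> beta X v t n @[n --> \oo] --> (0 : R).
Proof.
move=> t0; apply/cvgrPdist_le => e e0.
have [t' t'0 tt'] := nat_above t.
(* One error for the whole box and one for each of its pieces. *)
pose c : R := 1 + #|{ffun 'I_d -> bool}|%:R.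
have c0 : 0 < c by rewrite ltr_pwDl.
have ec0 : 0 < e / c by rewrite divr_gt0.
apply: filterS (level_uniform t'0 ec0) => n Hn.
rewrite sub0r normrN ger0_norm; last by rewrite /beta; exact: bigmax_ge_id.
apply: bigmax_le => [|[p1 p2] /= /forallP pt]; first exact: ltW.
pose q1 : {ffun 'I_d -> nat} := [ffun l => p1 l : nat].
pose q2 : {ffun 'I_d -> nat} := [ffun l => p2 l : nat].
pose g := margF X (v n) `^ theta.
have qt l : (q1 l + q2 l <= t' * n)%N.
  rewrite !ffunE -(ler_nat R) natrM; apply: (le_trans (pt l)).
  exact: ler_wpM2r.
have hsum : `|PM X (zvec [ffun l => q1 l + q2 l]%N) (v n) -
    g ^+ vol [ffun l => q1 l + q2 l]%N| <= e / c.
  by apply: Hn => l; rewrite ffunE.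
have hs (s : {ffun 'I_d -> bool}) :
    `|PM X (zvec [ffun l => if s l then q2 l else q1 l]) (v n) -
    g ^+ vol [ffun l => if s l then q2 l else q1 l]| <= e / c.
  apply: Hn => l; rewrite ffunE; apply: leq_trans (qt l).
  by case: ifP => _; rewrite ?leq_addr ?leq_addl.
have -> : zvec (fun l => p1 l + p2 l)%N = zvec [ffun l => q1 l + q2 l]%N.
  by apply/ffunP => l; rewrite !ffunE.
have -> : \prod_(s : {ffun 'I_d -> bool})
    PM X (zvec (fun l => if s l then p2 l : nat else p1 l : nat)) (v n) =
   \prod_(s : {ffun 'I_d -> bool})
    PM X (zvec [ffun l => if s l then q2 l else q1 l]) (v n).
  apply: eq_bigr => s _; congr (PM X _ _); apply/ffunP => l.
  by rewrite !ffunE; case: ifP; rewrite ?ffunE.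
rewrite -vol_split -prodrXr in hsum.
have hprod : `|\prod_(s : {ffun 'I_d -> bool})
     PM X (zvec [ffun l => if s l then q2 l else q1 l]) (v n) -
    \prod_(s : {ffun 'I_d -> bool}) g ^+ vol [ffun l => if s l then q2 l else q1 l]|
    <= #|{ffun 'I_d -> bool}|%:R * (e / c).
  apply: (le_trans (prod_lip (lexx 1) _ _)).
  - by move=> s; rewrite PM_ge0 PM_le1.
  - move=> s; have /andP[g0 g1] := margF_powR_itv (v n).
    by rewrite exprn_ge0 // exprn_ile1.
  rewrite expr1n mul1r; apply: (@le_trans _ _ (\sum_(s : {ffun 'I_d -> bool}) (e / c))).
    by apply: ler_sum => s _; exact: hs.
  by rewrite sumr_const mulr_natl.
have -> : e = e / c + #|{ffun 'I_d -> bool}|%:R * (e / c).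
  by rewrite -[X in X + _]mul1r -mulrDl -/c mulrC divfK // gt_eqF.
rewrite distrC in hprod.
exact: le_trans (ler_distD _ _ _) (lerD hsum hprod).
Qed.

End UniformToBeta.

(** * Quantiles of the marginal distribution *)

Section RegularLevels.
Context (R : realType) (disp : measure_display)
  (T : measurableType disp) (P : probability T R).
Variables (Y : {RV P >-> R}).
Local Notation F := (fun x => fine (cdf Y x)).

Definition quantile (a : R) : R := inf [set x | a <= F x].

Lemma quantile_nonempty a : a < 1 -> [set x | a <= F x] !=set0.
Proof.
move=> a1; have H : F x @[x --> +oo] --> (1 : R) by apply: fine_cvg; exact: cvg_cdfy1.
have [M [_ HM]] := cvgr_gt _ H _ a1.
by exists (M + 1); apply/ltW/HM; rewrite ltrDl.
Qed.

Lemma quantile_has_lbound a : 0 < a -> has_lbound [set x | a <= F x].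
Proof.
move=> a0; have H : F x @[x --> -oo] --> (0 : R) by apply: fine_cvg; exact: cvg_cdfNy0.
have [M [_ HM]] := cvgr_lt _ H _ a0.
exists (M - 1) => x /= ax; rewrite leNgt; apply/negP => xM.
have /= := HM (M - 1); rewrite ltrBlDr ltrDl => /(_ ltr01).
by rewrite ltNge (le_trans ax) //; apply: fine_cdf_homo; exact: ltW.
Qed.

Lemma quantile_le a x : 0 < a -> a <= F x -> quantile a <= x.
Proof. by move=> a0 ax; apply: ge_inf => //; exact: quantile_has_lbound. Qed.

Lemma le_quantile a x : a < 1 -> F x < a -> x <= quantile a.
Proof.
move=> a1 xa; apply: lb_le_inf; first exact: quantile_nonempty.
move=> y /= ay; rewrite leNgt; apply/negP => yx.
have := le_lt_trans (le_trans ay (fine_cdf_homo Y (ltW yx))) xa.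
by rewrite ltxx.
Qed.

Lemma quantile_homo a b : 0 < a -> b < 1 -> a <= b -> quantile a <= quantile b.
Proof.
move=> a0 b1 ab; apply: lb_le_inf; first exact: quantile_nonempty.
by move=> x /= bx; apply: quantile_le => //; exact: le_trans bx.
Qed.

(** Right continuity of the distribution function: the bound holds at every point to the right of
    the infimum. *)
Lemma cdf_quantile_ge a : 0 < a < 1 -> a <= F (quantile a).
Proof.
move=> /andP[a0 a1].
have H : F x @[x --> (quantile a)^'+] --> F (quantile a).
  apply: fine_cvg; rewrite fineK; first exact: cdf_right_continuous.
  by rewrite fin_num_measure //; exact: measurable_itv.
apply: (cvgr_to_ge H); near=> y.
have ya : quantile a < y by near: y; exact: nbhs_right_gt.
have [x /= ax xy] := inf_lt (quantile_nonempty a1) ya.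
by apply: (le_trans ax); apply: fine_cdf_homo; exact: ltW.
Unshelve. all: by end_near.
Qed.

(** The event is the increasing union of the events [Y <= q - 1 / (k + 1)], and at points below the
    infimum the distribution function is less than [a]. *)
Lemma Pr_lt_quantile a : 0 < a -> Pr P [set w | Y w < quantile a] <= a.
Proof.
move=> a0; set q := quantile a.
pose A k := [set w | Y w <= q - k.+1%:R^-1].
have mA k : measurable (A k) by exact: measurable_RV_le.
have UA : \bigcup_k A k = [set w | Y w < q].
  apply/seteqP; split => w /=.
    move=> [k _ /= h]; apply: (le_lt_trans h).
    by rewrite ltrBlDr ltrDl invr_gt0.
  move=> wq; have [k k0 hk] := nat_above (q - Y w)^-1.
  exists k => //; rewrite /A /= lerBrDr -lerBrDl.
  rewrite invf_ple ?posrE ?subr_gt0 //.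
  by apply: (le_trans hk); rewrite ler_nat.
have mU : measurable [set w | Y w < q] by exact: measurable_RV_lt.
have H : (P \o A) k @[k --> \oo] --> P (\bigcup_k A k).
  apply: nondecreasing_cvg_mu => //; first by rewrite UA.
  move=> m n mn; rewrite subsetEset => w /= h; apply: (le_trans h).
  by rewrite lerD2l lerN2 lef_pV2 ?posrE // ler_nat ltnS.
have H' : Pr P (A k) @[k --> \oo] --> Pr P [set w | Y w < q].
  by apply: fine_cvg; rewrite -PrE // -UA.
apply: (cvgr_to_le H'); apply: nearW => k.
rewrite -cdf_Pr leNgt; apply/negP => h.
have := quantile_le a0 (ltW h).
by rewrite -/q lerBrDr gerDl leNgt invr_gt0 ltr0Sn.
Qed.

End RegularLevels.

(** * Levels built from a regular tail *)

Section RegularLevelsLimit.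
Context (R : realType) (d : nat) (disp : measure_display)
  (T : measurableType disp) (P : probability T R).
Variables (X : {ffun 'I_d -> int} -> {RV P >-> R}).
Hypothesis d0 : (0 < d)%N.
Hypothesis hreg : tail_regular (X 0).

(** The factor 2 keeps the probability strictly between 0 and 1 already for [n = 1]. *)
Definition regular_level (n : nat) : R := quantile (X 0) (1 - (2 * n%:R ^+ d)^-1).

Let thr (n : nat) : R := 1 - (2 * n%:R ^+ d)^-1.

Lemma thr_itv n : (0 < n)%N -> 0 < thr n < 1.
Proof.
move=> n0; have nd : 1 <= n%:R ^+ d :> R by rewrite exprn_ege1 // ler1n.
have nd2 : 2 <= 2 * n%:R ^+ d :> R by rewrite ler_peMr.
rewrite /thr; apply/andP; split.
  rewrite subr_gt0 invf_lt1 ?posrE; lra.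
by rewrite ltrBlDr ltrDl invr_gt0; lra.
Qed.

Lemma thr_homo m n : (0 < m)%N -> (m <= n)%N -> thr m <= thr n.
Proof.
move=> m0 mn; have m0' : 0 < m%:R :> R by rewrite ltr0n.
have n0' : 0 < n%:R :> R by rewrite ltr0n (leq_trans m0).
rewrite lerD2l lerN2 lef_pV2 ?posrE ?mulr_gt0 ?exprn_gt0 //.
by rewrite ler_pM2l // lerXn2r ?nnegrE ?ler_nat.
Qed.

Lemma thr_cvg : thr n @[n --> \oo] --> (1 : R).
Proof.
apply/cvgrPdist_le => e e0; have [N N0 hN] := nat_above e^-1.
near=> n.
have n0 : (0 < n)%N by near: n; exact: nbhs_infty_gt.
have Nn : (N <= n)%N by near: n; exact: nbhs_infty_ge.
have n1 : 1 <= n%:R :> R by rewrite ler1n.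
have nd : n%:R <= n%:R ^+ d :> R by rewrite -[leLHS]expr1 ler_weXn2l.
rewrite /thr opprB addrC subrK ger0_norm ?invr_ge0 ?mulr_ge0 ?exprn_ge0 //.
rewrite invf_ple ?posrE ?mulr_gt0 ?exprn_gt0 ?ltr0n //.
have : N%:R <= n%:R :> R by rewrite ler_nat.
by move: hN; lra.
Unshelve. all: by end_near.
Qed.

Lemma regular_level_homo m n : (0 < m)%N -> (m <= n)%N ->
  regular_level m <= regular_level n.
Proof.
move=> m0 mn; apply: quantile_homo; last exact: thr_homo.
  by case/andP: (thr_itv m0).
by case/andP: (thr_itv (leq_trans m0 mn)).
Qed.

(** The first half of [tail_regular] gives a point where the distribution function lies strictly
    between [thr n] and 1; the quantile is at most this point. *)
Lemma margF_regular_level_lt1 n : (0 < n)%N -> margF X (regular_level n) < 1.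
Proof.
move=> n0; have /andP[t0 t1] := thr_itv n0.
have [x /andP[xt x1]] : exists x, thr n < fine (cdf (X 0) x) < 1.
  by apply: hreg.1; move: t1; rewrite /thr ltrBlDr ltrDl.
apply: le_lt_trans x1; apply: fine_cdf_homo; apply: quantile_le => //.
exact: ltW.
Qed.

(** At [u = regular_level n], the number [1 / (2 n^d)] lies between P(X > u) and P(X >= u). The
    second half of [tail_regular] makes the ratio of these two tend to 1. *)
Lemma regular_tail_cvg :
  n%:R ^+ d * (1 - margF X (regular_level n)) @[n --> \oo] --> (2^-1 : R).
Proof.
apply/cvgrPdist_le => e e0; have [x0 x01 hx0] := hreg.2 e e0.
near=> n.
have n0 : (0 < n)%N by near: n; exact: nbhs_infty_gt.
have nd0 : 0 < n%:R ^+ d :> R by rewrite exprn_gt0 ?ltr0n.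
have /andP[t0 t1] := thr_itv n0.
have x0t : fine (cdf (X 0) x0) < thr n.
  by near: n; exact: cvgr_gt thr_cvg _ x01.
set u := regular_level n.
have x0u : x0 <= u by apply: le_quantile.
have Fu1 : margF X u < 1 by exact: margF_regular_level_lt1.
have Fut : thr n <= margF X u by apply: cdf_quantile_ge; exact/andP.
have := hx0 u x0u Fu1.
have -> : Pr P [set w | u < X 0 w] = 1 - margF X u.
  by rewrite RV_leC PrC ?/margF ?cdf_Pr //; exact: measurable_RV_le.
have -> : [set w | u <= X 0 w] = ~` [set w | X 0 w < u].
  by apply/seteqP; split => w /=; rewrite leNgt => /negP.
rewrite PrC; last exact: measurable_RV_lt.
have := @Pr_lt_quantile _ _ _ _ (X 0) (thr n) t0; rewrite -/(regular_level n) -/u.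
set b := Pr P _; set f := margF X u in Fu1 Fut * => bt.
have w0 : 0 < 1 - f by rewrite subr_gt0.
rewrite ltr_norml => /andP[_]; rewrite ltrBlDr ltr_pdivrMr // => hlt.
have tE : n%:R ^+ d * (1 - thr n) = 2^-1.
  by rewrite /thr; field; rewrite gt_eqF.
have up : n%:R ^+ d * (1 - f) <= 2^-1 by rewrite -tE ler_pM2l // lerD2l lerN2.
have lo : 2^-1 <= (e + 1) * (n%:R ^+ d * (1 - f)).
  rewrite -tE mulrCA ler_pM2l //; apply: le_trans (ltW hlt).
  by rewrite lerD2l lerN2.
have : e * (n%:R ^+ d * (1 - f)) <= e * 2^-1 by rewrite ler_pM2l.
by rewrite ler_norml; move=> H; apply/andP; split; lra.
Unshelve. all: by end_near.
Qed.

(** The power is the exponential of [n^d * ln f], and replacing [- ln f] by [1 - f] costs only a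
    second-order term, so [regular_tail_cvg] determines the limit. *)
Lemma regular_level_cvg :
  margF X (regular_level n) ^+ (n ^ d)%N @[n --> \oo] --> expR (- 2^-1 : R).
Proof.
apply/cvgrPdist_le => e e0; have e2 : 0 < e / 2 by rewrite divr_gt0.
have [N N0 hN] := nat_above (e / 2)^-1.
near=> n.
have n0 : (0 < n)%N by near: n; exact: nbhs_infty_gt.
have n1 : 1 <= n%:R :> R by rewrite ler1n.
have Nn : (N <= n)%N by near: n; exact: nbhs_infty_ge.
have nd0 : 0 < n%:R ^+ d :> R by rewrite exprn_gt0 ?ltr0n.
have ndn : n%:R <= n%:R ^+ d :> R by rewrite -[leLHS]expr1 ler_weXn2l.
have hw : `|n%:R ^+ d * (1 - margF X (regular_level n)) - 2^-1| <= e / 2.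
  by near: n; apply: cvg_near_dist => //; exact: regular_tail_cvg.
set f := margF X (regular_level n) in hw *.
have /andP[t0 t1] := thr_itv n0.
have ft : thr n <= f by apply: cdf_quantile_ge; exact/andP.
have f0 : 0 < f by exact: lt_le_trans ft.
have f1 : f < 1 by exact: margF_regular_level_lt1.
have wN : 1 - f <= (2 * n%:R ^+ d)^-1 by move: ft; rewrite /thr; lra.
have -> : f ^+ (n ^ d) = expR (- - (n%:R ^+ d * ln f)).
  by rewrite opprK -natrX expRM_natl lnK.
have lnf : ln f <= 0 by rewrite -ln1 ler_ln ?posrE // ltW.
have s0 : 0 <= - (n%:R ^+ d * ln f).
  by rewrite -mulrN mulr_ge0 ?(ltW nd0) // oppr_ge0.
apply: (le_trans (expRN_lip _ s0)) => //; rewrite distrC.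
have lo : n%:R ^+ d * (1 - f) <= - (n%:R ^+ d * ln f).
  by rewrite -mulrN ler_pM2l //; exact: one_subr_le_ln.
have fV0 : 0 < f^-1 by rewrite invr_gt0.
have lnle : - ln f <= f^-1 - 1.
  by have := one_subr_le_ln fV0; rewrite lnV ?posrE //; lra.
have y2 : 2 <= 2 * n%:R ^+ d :> R by move: n1 ndn; lra.
have fh : 2^-1 <= f.
  apply: le_trans ft; rewrite /thr.
  have : (2 * n%:R ^+ d)^-1 <= 2^-1 :> R.
    by rewrite lef_pV2 ?posrE ?mulr_gt0.
  by lra.
(* Uses [- ln f <= f^-1 - 1], the identity [f^-1 - 1 - (1 - f) = (1 - f)^2 / f], and [2^-1 <= f]. *)
have gap : - ln f - (1 - f) <= 2 * (1 - f) * (1 - f).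
  have -> : 2 * (1 - f) * (1 - f) = 2 * f * ((1 - f) * (1 - f) / f).
    by field; rewrite gt_eqF.
  have E : f^-1 - 1 - (1 - f) = (1 - f) * (1 - f) / f by field; rewrite gt_eqF.
  apply: (@le_trans _ _ (f^-1 - 1 - (1 - f))); first by rewrite lerD2r.
  rewrite E ler_peMl //; last by lra.
  by rewrite divr_ge0 ?mulr_ge0 ?subr_ge0 ?(ltW f0) ?(ltW f1).
have tE : n%:R ^+ d * (2 * n%:R ^+ d)^-1 = 2^-1 :> R by field; rewrite gt_eqF.
have half : n%:R ^+ d * (1 - f) <= 2^-1 by rewrite -tE ler_pM2l.
have gap' : - (n%:R ^+ d * ln f) - n%:R ^+ d * (1 - f) <= 1 - f.
  have -> : - (n%:R ^+ d * ln f) - n%:R ^+ d * (1 - f) =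
    n%:R ^+ d * (- ln f - (1 - f)) by ring.
  apply: (@le_trans _ _ (n%:R ^+ d * (2 * (1 - f) * (1 - f)))).
    by rewrite ler_pM2l.
  have -> : n%:R ^+ d * (2 * (1 - f) * (1 - f)) =
     2 * (n%:R ^+ d * (1 - f)) * (1 - f) by ring.
  apply: ler_piMl; first by rewrite subr_ge0 ltW.
  by lra.
have wsmall : 1 - f <= e / 2.
  apply: (le_trans wN); rewrite invf_ple ?posrE ?mulr_gt0 //.
  have : N%:R <= n%:R :> R by rewrite ler_nat.
  by move: hN; lra.
move: hw; rewrite !ler_norml => /andP[? ?]; apply/andP; split; lra.
Unshelve. all: by end_near.
Qed.

End RegularLevelsLimit.

(** * Sectorial extremal index and levels: both implications assembled *)

Theorem theorem1p15 (R : realType) (d : nat) (hd : (0 < d)%N)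
    (disp : measure_display) (T : measurableType disp) (P : probability T R)
    (X : {ffun 'I_d -> int} -> {RV P >-> R}) (hX : stationary X)
    (theta : R) (htheta : 0 < theta <= 1) :
  ((exists gor gin : R, exists v : nat -> R,
      [/\ 0 < gor < 1, 0 < gin < 1 & sectorial_levels X theta gor gin v]) ->
   sectorial_extremal_index X theta) /\
  (tail_regular (X 0) ->
   sectorial_extremal_index X theta ->
   exists gor gin : R, exists v : nat -> R,
     [/\ 0 < gor < 1, 0 < gin < 1 & sectorial_levels X theta gor gin v]).
Proof.
have /andP[theta0 theta1] := htheta; split.
  move=> [gor [gin [v [/andP[gor0 gor1] /andP[gin0 gin1] [_ hgor hgin thetaE hbeta]]]]].
  split; first exact: distribution_function_powR.
  move=> phi; apply: uniform_phantom_along => //.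
  exact: (levels_uniform_phantom gin0 gin1 hgin hX gor0 gor1 hgor hbeta thetaE).
move=> hreg [_ hphi].
pose gin : R := expR (- 2^-1); pose v := regular_level X.
have gin0 : 0 < gin by exact: expR_gt0.
have gin1 : gin < 1 by rewrite -expR0 ltr_expR oppr_lt0 invr_gt0.
have hgin : margF X (v n) ^+ (n ^ d)%N @[n --> \oo] --> gin.
  exact: regular_level_cvg.
have hunif : uniform_phantom X (fun x => margF X x `^ theta).
  by apply: phantom_uniform => // x; exact: margF_powR_itv.
have lgin : ln gin < 0 by rewrite ln_lt0 // gin0.
have gorE : gin `^ theta = expR (theta * ln gin) by rewrite /powR gt_eqF.
(* With [gor] the [theta]-th power of [gin], the ratio of logarithms is [theta]. *)
exists (gin `^ theta), gin, v; split.
- rewrite powR_gt0 //= gorE -expR0 ltr_expR.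
  by rewrite pmulr_rlt0.
- exact/andP.
split.
- by move=> m n; exact: regular_level_homo.
- exact: level_cube_cvg.
- exact: hgin.
- by rewrite gorE expRK mulfK // lt_eqF.
- by move=> t; apply: (level_beta_cvg hX hd gin0 gin1 hgin theta0 theta1 hunif).
Qed.
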